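(* Let $d \geq 2$ and let $B$ be a smooth closed $2$-form on $\mathbb{R}^d$ (i.e. $\mathrm{d}B=0$). If $B \neq 0$ (i.e. $B$ is not identically zero), then there exists a positive constant $c_{d,B}$ (depending only on $d$ and $B$) such that for every smooth real $1$-form $A$ on $\mathbb{R}^d$ satisfying $\mathrm{d}A = B$ and every $\psi \in C_0^\infty(\mathbb{R}^d)$, $$ \int_{\mathbb{R}^d} |(\nabla-iA)\psi(x)|^2 \, \mathrm{d}x - c_d \int_{\mathbb{R}^d} \frac{|\psi(x)|^2}{|x|^2} \, \mathrm{d}x \;\geq\; c_{d,B} \int_{\mathbb{R}^d} \frac{|\psi(x)|^2}{1+|x|^2 \log^2(|x|)} \, \mathrm{d}x , $$ where $c_d := \left(\frac{d-2}{2}\right)^2$.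
   Context: A smooth real $1$-form $A = A_j\,\mathrm{d}x^j$ on $\mathbb{R}^d$ is identified with the vector field $A=(A_1,\dots,A_d):\mathbb{R}^d\to\mathbb{R}^d$; $\mathrm{d}$ is the exterior derivative, so $\mathrm{d}A = B$ means $B_{jk} = \partial_j A_k - \partial_k A_j$. Functions $\psi \in C_0^\infty(\mathbb{R}^d)$ (smooth, compactly supported) are complex-valued. When $d=2$, $c_2=0$ and the second term on the left-hand side is understood to be absent. *)

(* Defs.v *)
From HB Require Import structures.
From mathcomp Require Import all_boot all_order all_algebra.
From mathcomp Require Import all_classical all_reals all_analysis.
From mathcomp Require Import complex.

Set Implicit Arguments.
Unset Strict Implicit.
Unset Printing Implicit Defensive.

Import Order.TTheory GRing.Theory Num.Theory.
Import numFieldNormedType.Exports.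
Import ComplexField.Normc.

Local Open Scope classical_set_scope.
Local Open Scope ring_scope.

Lemma product_sigma_finite d1 d2 (T1 : measurableType d1)
    (T2 : measurableType d2) (R : realType)
    (m1 : {sigma_finite_measure set T1 -> \bar R})
    (m2 : {sigma_finite_measure set T2 -> \bar R}) :
  sigma_finite setT (m1 \x m2)%E.
Proof.
have /sigma_finiteP[F [TF ndF Foo]] := sigma_finiteT m1.
have /sigma_finiteP[G [TG ndG Goo]] := sigma_finiteT m2.
exists (fun n => F n `*` G n).
  rewrite -setXTT TF TG predeqE => -[x y]; split.
    move=> [/= [n _ Fnx] [k _ Gky]]; exists (maxn n k) => //; split.
    - by move: x Fnx; exact/subsetPset/ndF/leq_maxl.
    - by move: y Gky; exact/subsetPset/ndG/leq_maxr.
  by move=> [n _ []/= ? ?]; split; exists n.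
move=> k; have [? ?] := Foo k; have [? ?] := Goo k.
split; first exact: measurableX.
by rewrite product_measure1E// lte_mul_pinfty// ge0_fin_numE.
Qed.

(* Lebesgue measure on R^n, on n-tuples with the product sigma-algebra: the
   image of (1-dimensional Lebesgue) \x (Lebesgue on R^n) under consing. *)
Section lebesgue_tuple.
Context {R : realType}.
Local Open Scope ereal_scope.
Local Notation T := (measurableTypeR R).

Definition cons_pair n (p : T * n.-tuple T) : n.+1.-tuple T :=
  [tuple of p.1 :: p.2].

Lemma measurable_cons_pair n : measurable_fun [set: _] (@cons_pair n).
Proof. exact: (measurable_cons measurable_fst measurable_snd). Qed.

Section cons_measure.
Variables (n : nat) (mu : {sigma_finite_measure set (n.-tuple T) -> \bar R}).

Definition cons_measure : set (n.+1.-tuple T) -> \bar R :=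
  pushforward (@lebesgue_measure R \x mu) (@cons_pair n).

Let cons_measure0 : cons_measure set0 = 0.
Proof. by rewrite /cons_measure /pushforward preimage_set0 measure0. Qed.

Let cons_measure_ge0 A : 0 <= cons_measure A.
Proof. exact: (measure_ge0 (@lebesgue_measure R \x mu)). Qed.

Let cons_measure_sigma_additive : semi_sigma_additive cons_measure.
Proof.
move=> F mF tF mUF; rewrite /cons_measure /pushforward preimage_bigcup.
apply: (measure_semi_sigma_additive (s := @lebesgue_measure R \x mu)).
- by move=> k; rewrite -[X in measurable X]setTI; exact: measurable_cons_pair.
- apply/trivIsetP => /= i j _ _ ij; rewrite -preimage_setI.
  by move/trivIsetP : tF => /(_ _ _ _ _ ij) ->//; rewrite preimage_set0.
- rewrite -preimage_bigcup -[X in measurable X]setTI.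
  exact: measurable_cons_pair.
Qed.

HB.instance Definition _ := isMeasure.Build _ _ _ cons_measure
  cons_measure0 cons_measure_ge0 cons_measure_sigma_additive.

Let measurable_uncons :
  measurable_fun [set: n.+1.-tuple T]
    (fun t => (thead t, [tuple of behead t]) : T * n.-tuple T).
Proof.
apply/measurable_fun_pair; first exact: measurable_tnth.
exact: measurable_behead.
Qed.

Let cons_measure_sigma_finite : sigma_finite setT cons_measure.
Proof.
have [F TF mF] := @product_sigma_finite _ _ _ _ _ (@lebesgue_measure R) mu.
pose u (t : n.+1.-tuple T) : T * n.-tuple T := (thead t, [tuple of behead t]).
have uK p : u (cons_pair p) = p.
  by case: p => a s; congr pair; apply: val_inj.
exists (fun k => u @^-1` F k).
  by rewrite -preimage_bigcup -TF preimage_setT.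
move=> k; have [mFk Fk] := mF k; split.
  by rewrite -[X in measurable X]setTI; exact: measurable_uncons.
rewrite /cons_measure /pushforward -comp_preimage.
by rewrite (_ : _ @^-1` _ = F k)//; apply/seteqP; split => p /=; rewrite uK.
Qed.

HB.instance Definition _ := Measure_isSigmaFinite.Build _ _ _ cons_measure
  cons_measure_sigma_finite.

End cons_measure.

Fixpoint lebesgue_tuple n : {sigma_finite_measure set (n.-tuple T) -> \bar R} :=
  if n is m.+1 then cons_measure (lebesgue_tuple m) else \d_[tuple].

Lemma lebesgue_tuple_box n (I : 'I_n -> set T) :
  (forall i, measurable (I i)) ->
  lebesgue_tuple n [set t | forall i, I i (tnth t i)] =
  \prod_(i < n) lebesgue_measure (I i).
Proof.
elim: n I => [|n IH] I mI.
  rewrite big_ord0 /= diracE mem_set//= => -[].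
  by case.
rewrite big_ord_recl /= -IH; last by move=> i; exact: mI.
rewrite -product_measure1E//; last first.
  rewrite (_ : [set _ | _] =
    \bigcap_(i in [set: 'I_n]) ((@tnth _ T ^~ i) @^-1` I (lift ord0 i))); last first.
    by apply/seteqP; split => [t /= h i _|t h i]; [exact: h|exact: (h i)].
  apply: fin_bigcap_measurable => //= i _.
  by rewrite -[X in measurable X]setTI; exact: measurable_tnth.
rewrite /cons_measure /pushforward; congr (_ _).
apply/seteqP; split => -[a s] /=.
- move=> h; split; first exact: (h ord0).
  by move=> i; have := h (lift ord0 i); rewrite tnthS.
- move=> [ha hs] i; case: (unliftP ord0 i) => [j ->|->].
  + by rewrite tnthS; exact: hs.
  + exact: ha.
Qed.

End lebesgue_tuple.

Section euclidean_space.
Context {R : realType} {d : nat}.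
Implicit Types (x : 'rV[R]_d) (f : 'rV[R]_d -> R) (psi : 'rV[R]_d -> R[i]).

Definition integral_Rd (F : 'rV[R]_d -> \bar R) : \bar R :=
  (\int[@lebesgue_tuple R d]_(t in [set: d.-tuple (measurableTypeR R)])
     F (\row_i tnth t i))%E.

(* The library norm `|x| of a row vector is the sup norm. *)
Definition enorm x : R := Num.sqrt (\sum_(i < d) x 0 i ^+ 2).

Definition partial (j : 'I_d) f : 'rV[R]_d -> R :=
  fun x => 'D_(delta_mx 0 j) f x.

Definition iter_partial (s : seq 'I_d) f : 'rV[R]_d -> R := foldr partial f s.

Definition smooth f : Prop := forall s : seq 'I_d,
  continuous (iter_partial s f) /\
  (forall j x, derivable (iter_partial s f) x (delta_mx 0 j)).

Definition smoothC psi : Prop :=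
  smooth (fun x => complex.Re (psi x)) /\ smooth (fun x => complex.Im (psi x)).

Definition test_function psi : Prop :=
  smoothC psi /\ compact (closure [set x | psi x != 0]).

(* R[i] is not a normed module over R in the library, so complex-valued
   functions are differentiated componentwise. *)
Definition partialC (j : 'I_d) psi x : R[i] :=
  (partial j (fun y => complex.Re (psi y)) x
   +i* partial j (fun y => complex.Im (psi y)) x)%C.

Implicit Types (A : 'rV[R]_d -> 'rV[R]_d) (B : 'rV[R]_d -> 'M[R]_d).

(* A 2-form \sum_(j < k) B_jk dx^j /\ dx^k is its antisymmetric coefficient
   matrix. *)
Definition smooth_1form A : Prop := forall j, smooth (fun x => A x 0 j).

Definition smooth_2form B : Prop :=
  (forall x, (B x)^T = - B x) /\ (forall j k, smooth (fun x => B x j k)).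

Definition ext_d1 A : 'rV[R]_d -> 'M[R]_d := fun x =>
  \matrix_(j, k) (partial j (fun y => A y 0 k) x - partial k (fun y => A y 0 j) x).

Definition ext_d2 B (i j k : 'I_d) : 'rV[R]_d -> R := fun x =>
  partial i (fun y => B y j k) x + partial j (fun y => B y k i) x
  + partial k (fun y => B y i j) x.

Definition closed_2form B : Prop := forall i j k x, ext_d2 B i j k x = 0.

Definition magnetic_grad A psi x : 'rV[R[i]]_d :=
  \row_j (partialC j psi x - 'i%C * (A x 0 j)%:C%C * psi x).

Definition magnetic_grad_sqnorm A psi x : R :=
  \sum_(j < d) normc (magnetic_grad A psi x 0 j) ^+ 2.

End euclidean_space.

Definition hardy_const (R : realType) (d : nat) : R := ((d%:R - 2) / 2) ^+ 2.

(* Main.v *)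
Require Import Defs.
From mathcomp Require Import all_boot all_order all_algebra.
From mathcomp Require Import all_classical all_reals all_analysis.
From mathcomp Require Import complex measurable_realfun ring lra.
Set Implicit Arguments.
Unset Strict Implicit.
Unset Printing Implicit Defensive.
Import Order.TTheory GRing.Theory Num.Theory.
Import numFieldNormedType.Exports.
Import ComplexField.Normc.
Local Open Scope ring_scope.

(** Every inequality below comes from expanding a square pointwise and adding
    divergences of compactly supported fields, which integrate to zero; the
    constants do not depend on [A].  Put [a = (d-2)/2], [P = grad - i A] and let
    [V = a x / (|x|^2 + eta)], a regularisation of the Hardy field, with
    [0 < eta <= 1].
    - Up to a divergence, [|P psi|^2] equals [|(P + V) psi|^2] plus a potential
      that is at least [a^2 |x|^2 / (|x|^2 + eta)^2].
    - Expanding [|(P + V + W) psi|^2 >= 0] for a second real field [W], made of a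
      logarithmic field centred at a point [z] and a field centred at the origin,
      bounds [|(P + V) psi|^2] from below by the weight [1 / (1 + |x|^2 log^2 |x|)],
      except on a small ball around [z], where a constant [C] is lost.
    - If the coefficient [B_jk] is positive near [z <> 0], the commutator
      [[P_j + V_j, P_k + V_k] = - i B_jk], localised by a cutoff, shows that
      [|psi|^2] near [z] is controlled by [|(P + V) psi|^2] and a small multiple of
      the weighted density, which absorbs [C].
    Finally [eta] tends to [0] by monotone convergence. *)

(** * Integration by parts for the Lebesgue measure on tuples *)

Section measure.
Local Open Scope classical_set_scope.
Context {R : realType}.
Local Notation T := (measurableTypeR R).

(** The fundamental theorem of calculus on the interval with endpoints [- (|N| + 1)] and [|N| + 1]:
    [F] vanishes at both, and [G] vanishes outside. The absolute value keeps the interval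
    nondegenerate when [N] is negative. *)
Lemma integral_deriv_eq0 (F G : R -> R) (N : R) :
  (forall u : R, is_derive u 1 F (G u)) -> continuous G ->
  (forall u, N < `|u| -> F u = 0 /\ G u = 0) ->
  (\int[@lebesgue_measure R]_u (G u)%:E = 0)%E.
Proof.
move=> dF cG FG0.
have N0 : `|N| + 1 > 0 by rewrite ltr_wpDl.
have ab : - (`|N| + 1) < `|N| + 1 by rewrite gtrN.
have cF : continuous F.
  move=> u; apply/differentiable_continuous/derivable1_diffP.
  exact: ex_derive.
have := @continuous_FTC2 R G F _ _ ab (continuous_subspaceT cG).
have FN u : u = `|N| + 1 \/ u = - (`|N| + 1) -> F u = 0.
  move=> uE; apply: (FG0 u _).1; rewrite (_ : `|u| = `|N| + 1).
    by rewrite (le_lt_trans (ler_norm _))// ltrDl.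
  by case: uE => ->; rewrite ?normrN gtr0_norm.
rewrite !FN; [|by right|by left].
rewrite subee// => <-.
- rewrite [RHS]integral_mkcond; apply: eq_integral => u _.
  rewrite patchE; case: ifPn => // /negP; rewrite inE/= in_itv/= => /negP uN.
  rewrite (FG0 u _).2//; move: uN; rewrite -ler_norml -ltNge.
  by apply: le_lt_trans; rewrite (le_trans (ler_norm _))// lerDl.
- split.
  + by move=> u _; exact: ex_derive.
  + by apply: cvg_at_right_filter; exact: cF.
  + by apply: cvg_at_left_filter; exact: cF.
- by move=> u _; rewrite derive1E derive_val.
Qed.

Definition upd n (t : n.-tuple R) (j : 'I_n) (w : R) : n.-tuple R :=
  [tuple (if i == j then w else tnth t i) | i < n].

Lemma tnth_cons0 n (a : R) (s : n.-tuple R) : tnth (cons_pair (a, s)) ord0 = a.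
Proof. by []. Qed.

Lemma tnth_consS n (a : R) (s : n.-tuple R) i :
  tnth (cons_pair (a, s)) (lift ord0 i) = tnth s i.
Proof. by rewrite tnthS; congr tnth; exact: val_inj. Qed.

Lemma upd_cons0 n (a w : R) (s : n.-tuple R) :
  upd (cons_pair (a, s)) ord0 w = cons_pair (w, s).
Proof.
apply: eq_from_tnth => i; rewrite tnth_mktuple.
by case: (unliftP ord0 i) => [k ->|->]; rewrite ?tnth_consS ?tnth_cons0.
Qed.

Lemma upd_consS n (a w : R) (s : n.-tuple R) j :
  upd (cons_pair (a, s)) (lift ord0 j) w = cons_pair (a, upd s j w).
Proof.
apply: eq_from_tnth => i; rewrite tnth_mktuple.
case: (unliftP ord0 i) => [k ->|->]; rewrite ?tnth_consS ?tnth_cons0//.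
by rewrite (inj_eq lift_inj) tnth_mktuple.
Qed.

Definition box n (N : R) : set (n.-tuple T) :=
  [set t | forall i, `|tnth t i| <= N].

Lemma measurable_box n N : measurable (@box n N).
Proof.
rewrite (_ : box _ = \bigcap_(i in [set: 'I_n])
    ((@tnth _ T ^~ i) @^-1` (`[- N, N]%classic : set R))).
  apply: fin_bigcap_measurable => // i _.
  rewrite -[X in measurable X]setTI.
  have m : measurable_fun [set: n.-tuple T] (@tnth _ T ^~ i) by exact: measurable_tnth.
  by apply: m => //; exact: measurable_itv.
apply/seteqP; split => [t h i _|t h i] /=.
  by rewrite in_itv/= -ler_norml; exact: h.
by have := h i I; rewrite /= in_itv/= -ler_norml.
Qed.

Lemma lebesgue_tuple_box_lty n N : (lebesgue_tuple n (@box n N) < +oo)%E.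
Proof.
pose J (i : 'I_n) : set T := `[- N, N]%classic.
rewrite (_ : box _ = [set t | forall i, J i (tnth t i)]); last first.
  by apply/seteqP; split => t h i; have := h i; rewrite /J /= in_itv/= -ler_norml.
rewrite (@lebesgue_tuple_box R n J); last by move=> i; exact: measurable_itv.
rewrite -ge0_fin_numE; last exact: prode_ge0.
apply: prode_fin_num => i _; rewrite /J lebesgue_measure_itv/=.
by case: ifP.
Qed.

Lemma integrable_tuple n (G : n.-tuple T -> R) (N M : R) :
  measurable_fun [set: _] G -> (forall t, `|G t| <= M) ->
  (forall t, ~ box N t -> G t = 0) ->
  (lebesgue_tuple n).-integrable [set: _] (EFin \o G).
Proof.
move=> mG GM G0.
have -> : EFin \o G = (EFin \o G) \_ (@box n N).
  apply/funext => t; rewrite patchE; case: ifPn => // /negP tN /=.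
  by rewrite G0//; move: tN; rewrite inE.
have mB := @measurable_box n N.
have [h _] := @integrable_mkcond _ _ R (lebesgue_tuple n) _ (EFin \o G) mB.
apply: h.
apply: measurable_bounded_integrable => //.
- exact: lebesgue_tuple_box_lty.
- exact: measurable_funTS.
- exists M; split; first by rewrite num_real.
  by move=> x Mx t _; apply: le_trans (GM t) _; exact: ltW.
Qed.

(** Induction on [n] with Fubini, the order of integration being chosen so that the inner integral
    vanishes: over the tail, by induction, when [j] is a tail coordinate, and over the head, by
    [integral_deriv_eq0], when [j] is the first one. Derivatives and continuity are only asked along
    the slices [upd t j]. *)
Lemma integral_tuple_deriv_eq0 n (j : 'I_n) (F G : n.-tuple T -> R) (N M : R) :
  measurable_fun [set: _] G -> (forall t, `|G t| <= M) ->
  (forall t, ~ box N t -> F t = 0 /\ G t = 0) ->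
  (forall t (u : R), is_derive u 1 (fun w => F (upd t j w)) (G (upd t j u))) ->
  (forall t, continuous (fun u => G (upd t j u))) ->
  (\int[lebesgue_tuple n]_t (G t)%:E = 0)%E.
Proof.
elim: n => [|n IH] in j F G *; first by case: j.
move=> mG GM FG0 dF cG.
have iG := @integrable_tuple _ G N M mG GM (fun t h => (FG0 t h).2).
have mGc : measurable_fun [set: T * n.-tuple T] (G \o @cons_pair R n).
  by apply: measurableT_comp => //; exact: measurable_cons_pair.
have iGc : (@lebesgue_measure R \x lebesgue_tuple n)%E.-integrable setT
    (EFin \o (G \o @cons_pair R n)).
  apply/integrableP; split; first exact/measurable_EFinP.
  move/integrableP : iG => [_]; apply: le_lt_trans.
  rewrite /= ge0_integral_pushforward//=; first exact: measurable_cons_pair.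
  by apply/measurable_EFinP; exact: measurableT_comp.
transitivity (\int[(@lebesgue_measure R \x lebesgue_tuple n)%E]_p
   (G (cons_pair p))%:E)%E.
  rewrite /= integral_pushforward//=; first exact: measurable_cons_pair.
  exact/measurable_EFinP.
have boxN a s i : N < `|tnth (cons_pair (a, s)) i| -> ~ @box n.+1 N (cons_pair (a, s)).
  by move=> h /(_ i); rewrite leNgt h.
case: (unliftP ord0 j) => [k|] jE; rewrite jE in dF cG.
- rewrite -(integral12_prod_meas1 iGc)/= /fubini_F.
  rewrite (eq_integral (cst 0%E)) ?integral_cst ?mul0e// => a _ /=.
  apply: (IH k (fun s => F (cons_pair (a, s)))).
  + apply: (measurableT_comp mGc) => /=; exact: pair1_measurable.
  + by move=> t; exact: GM.
  + move=> t tN; apply: FG0 => h; apply: tN => i.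
    by have := h (lift ord0 i); rewrite tnth_consS.
  + move=> t u; have := dF (cons_pair (a, t)) u.
    by rewrite (_ : (fun w => _) = (fun w => F (cons_pair (a, upd t k w))));
      [rewrite upd_consS|apply/funext => w; rewrite upd_consS].
  + move=> t; have := cG (cons_pair (a, t)).
    by rewrite (_ : (fun w => _) = (fun w => G (cons_pair (a, upd t k w))))//;
      apply/funext => w; rewrite upd_consS.
- rewrite -(integral21_prod_meas1 iGc)/= /fubini_G.
  rewrite (eq_integral (cst 0%E)) ?integral_cst ?mul0e// => s _ /=.
  apply: (@integral_deriv_eq0 (fun a => F (cons_pair (a, s))) _ N).
  + move=> u; have := dF (cons_pair (0, s)) u.
    by rewrite (_ : (fun w => _) = (fun w => F (cons_pair (w, s))));
      [rewrite upd_cons0|apply/funext => w; rewrite upd_cons0].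
  + have := cG (cons_pair (0, s)).
    by rewrite (_ : (fun w => _) = (fun w => G (cons_pair (w, s))))//;
      apply/funext => w; rewrite upd_cons0.
  + by move=> u uN; apply: FG0; exact: (boxN _ _ ord0).
Qed.

End measure.

(** * Calculus with coordinate derivatives *)

Section calculus.
Local Open Scope classical_set_scope.
Context {R : realType} {d : nat}.
Local Notation T := (measurableTypeR R).
Local Notation E := 'rV[R]_d.
Implicit Types (F G : E -> R) (dF dG : 'I_d -> E -> R) (x v : E).

Definition row_of (t : d.-tuple T) : E := \row_i tnth t i.

(** Tuples carry the product sigma-algebra, so continuity does not give measurability at once.
    Sampling [F] at the lower corners of a grid of mesh [1 / (n + 1)] gives functions that are
    constant on countably many measurable cells; by continuity they converge pointwise to [F]. *)
Lemma continuous_measurable_row F :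
  continuous F -> measurable_fun [set: d.-tuple T] (F \o row_of).
Proof.
move=> cF.
pose a (n : nat) (z : d.-tuple int) : E := \row_i ((tnth z i)%:~R / n.+1%:R).
pose r (n : nat) (t : d.-tuple T) : d.-tuple int :=
  [tuple Num.floor (tnth t i * n.+1%:R) | i < d].
apply: (@measurable_fun_cvg _ _ _ _ (fun n t => F (a n (r n t)))).
  move=> n _ Y mY; rewrite setTI.
  rewrite (_ : _ @^-1` Y = \bigcup_(z in [set: d.-tuple int])
      (if F (a n z) \in Y then [set t | r n t = z] else set0)).
    apply: countable_bigcupT_measurable; first exact: countableP.
    move=> z; case: ifPn => // _.
    rewrite (_ : mkset _ = \bigcap_(i in [set: 'I_d]) ((@tnth _ T ^~ i) @^-1`
      (`[(tnth z i)%:~R / n.+1%:R, (tnth z i + 1)%:~R / n.+1%:R[%classic : set R))).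
      apply: fin_bigcap_measurable => // i _.
      rewrite -[X in measurable X]setTI.
      have m : measurable_fun [set: d.-tuple T] (@tnth _ T ^~ i).
        exact: measurable_tnth.
      by apply: m => //; exact: measurable_itv.
    apply/seteqP; split => [t /= <- i _|t h] /=.
      rewrite in_itv/= tnth_mktuple ler_pdivrMr// ltr_pdivlMr//.
      exact: floor_itv.
    apply: eq_from_tnth => i; rewrite tnth_mktuple; apply: floor_def.
    by have := h i I; rewrite /= in_itv/= ler_pdivrMr// ltr_pdivlMr.
  apply/seteqP; split => [t /= Yt|t [z _]].
    by exists (r n t) => //; rewrite mem_set.
  by case: ifPn => //; rewrite inE => Yz /= ->.
move=> t _; apply: (@cvg_comp _ _ _ (fun n => a n (r n t)) F _ (nbhs (row_of t))).
  apply/cvg_ballP => e e0; near=> n; split => // i j.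
  rewrite !mxE tnth_mktuple /ball/=.
  have /andP[h1 h2] := floor_itv (tnth t j * n.+1%:R).
  set m := Num.floor _ in h1 h2 *.
  have n0 : 0 < n.+1%:R :> R by [].
  have ->: tnth t j - m%:~R / n.+1%:R = (tnth t j * n.+1%:R - m%:~R) / n.+1%:R.
    by rewrite mulrBl mulfK// gt_eqF.
  rewrite normrM ger0_norm ?subr_ge0// gtr0_norm ?invr_gt0//.
  rewrite ltr_pdivrMr// (@lt_trans _ _ 1)//.
    by rewrite ltrBlDl; move: h2; rewrite intrD.
  rewrite -ltr_pdivrMl// mulr1.
  near: n; have [k _ hk] := near_infty_natSinv_lt (PosNum e0).
  exists k => // n /hk/=; rewrite -[in X in X -> _](invrK e).
  by rewrite ltf_pV2 ?posrE ?invr_gt0.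
exact: cF.
Unshelve. all: by end_near. Qed.

Lemma is_derive_line F (dF : E -> R) v x0 (u : R) :
  (forall x, is_derive x v F (dF x)) ->
  is_derive u 1 (fun w : R => F (w *: v + x0)) (dF (u *: v + x0)).
Proof.
move=> h; have [h1 h2] := h (u *: v + x0).
have e : (fun k : R => k^-1 *: (((fun w : R => F (w *: v + x0)) \o shift u) (k *: (1:R))
    - F (u *: v + x0))) =
  (fun k : R => k^-1 *: ((F \o shift (u *: v + x0)) (k *: v) - F (u *: v + x0))).
  by apply/funext => k /=; rewrite [k%:A]mulr1 scalerDl addrA.
by split; rewrite /derivable /derive e.
Qed.

Lemma is_derive_unique F x v (a b : R) :
  is_derive x v F a -> is_derive x v F b -> a = b.
Proof. by move=> [_ <-] [_ <-]. Qed.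

Lemma continuous_rowD F G : continuous F -> continuous G -> continuous (fun x => F x + G x).
Proof. by move=> cF cG x; have := continuousD (cF x) (cG x); exact. Qed.

Lemma continuous_rowM F G : continuous F -> continuous G -> continuous (fun x => F x * G x).
Proof. by move=> cF cG x; have := continuousM (cF x) (cG x); exact. Qed.

(** The gradient is carried as an explicit family, so that the closure lemmas below compute it by
    formula and [has_grad_ext] puts it into the shape wanted. *)
Definition has_grad F dF := [/\ continuous F, forall j, continuous (dF j) &
  forall j x, is_derive x (delta_mx 0 j) F (dF j x)].

Lemma has_grad_ext F G dF dG : F =1 G -> (forall j, dF j =1 dG j) ->
  has_grad F dF -> has_grad G dG.
Proof.
move=> /funext -> h; suff -> : dF = dG by [].
by apply/funext => j; apply/funext => x; exact: h.
Qed.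

Lemma has_grad_cst (a : R) : has_grad (fun=> a) (fun _ _ => 0).
Proof.
by split => [|j|j x]; [exact: cst_continuous|exact: cst_continuous|exact: is_derive_cst].
Qed.

Lemma has_gradD F G dF dG : has_grad F dF -> has_grad G dG ->
  has_grad (fun x => F x + G x) (fun j x => dF j x + dG j x).
Proof.
move=> [cF cdF hF] [cG cdG hG]; split => [|j|j x].
- by apply: continuous_rowD.
- by apply: continuous_rowD.
- by have := hF j x; have := hG j x => ? ?; exact: is_deriveD.
Qed.

Lemma has_gradM F G dF dG : has_grad F dF -> has_grad G dG ->
  has_grad (fun x => F x * G x) (fun j x => F x * dG j x + G x * dF j x).
Proof.
move=> [cF cdF hF] [cG cdG hG]; split => [|j|j x].
- by apply: continuous_rowM.
- by apply: continuous_rowD; apply: continuous_rowM.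
- have := hF j x; have := hG j x => ? ?.
  exact: is_deriveM.
Qed.

Lemma has_gradZ (a : R) F dF : has_grad F dF ->
  has_grad (fun x => a * F x) (fun j x => a * dF j x).
Proof.
move=> h; apply: has_grad_ext (has_gradM (has_grad_cst a) h) => // j x.
by rewrite mulr0 addr0.
Qed.

Lemma has_gradB F G dF dG : has_grad F dF -> has_grad G dG ->
  has_grad (fun x => F x - G x) (fun j x => dF j x - dG j x).
Proof.
move=> hF hG; apply: has_grad_ext (has_gradD hF (has_gradZ (-1) hG)) => [x|j x];
  by rewrite mulN1r.
Qed.

Lemma has_grad_coord k : has_grad (fun x => x 0 k) (fun j _ => (j == k)%:R).
Proof.
split => [|j|j x]; [exact: coord_continuous|exact: cst_continuous|].
suff e : (fun h : R => h^-1 *: (((fun y : E => y 0 k) \o shift x) (h *: delta_mx 0 j) - x 0 k))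
    @ 0^' --> ((j == k)%:R : R).
  by split; [apply/cvg_ex; eexists; exact: e|exact/cvg_lim].
apply: (@cvg_near_cst).
near=> h; rewrite /= !mxE/= addrK (eq_sym k).
rewrite /GRing.scale/= mulrA mulVf ?mul1r//.
by near: h; exact: nbhs_dnbhs_neq.
Unshelve. all: by end_near. Qed.

Lemma has_grad_sum (I : Type) (r : seq I) (F : I -> E -> R) (dF : I -> 'I_d -> E -> R) :
  (forall i, has_grad (F i) (dF i)) ->
  has_grad (fun x => \sum_(i <- r) F i x) (fun j x => \sum_(i <- r) dF i j x).
Proof.
move=> h; elim: r => [|i r IH].
  by apply: has_grad_ext (has_grad_cst 0) => [x|j x]; rewrite big_nil.
by apply: has_grad_ext (has_gradD (h i) IH) => [x|j x]; rewrite big_cons.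
Qed.

Lemma has_grad_comp (h h' : R -> R) F dF :
  (forall x, is_derive (F x) 1 h (h' (F x))) ->
  (forall x, {for F x, continuous h'}) ->
  has_grad F dF -> has_grad (h \o F) (fun j x => h' (F x) * dF j x).
Proof.
move=> dh ch' [cF cdF hF].
have dh1 x : differentiable h (F x) by apply/derivable1_diffP; case: (dh x).
split => [|j|j x].
- move=> x; apply: continuous_comp; first exact: cF.
  exact: differentiable_continuous.
- apply: continuous_rowM; last exact: cdF.
  by move=> x; apply: continuous_comp; [exact: cF|exact: ch'].
- set v := delta_mx 0 j.
  (* Along the line [w *: v + x] the composite depends on one real variable, so the one-dimensional
     chain rule at [w = 0] applies; its difference quotient is that of [h \o F] at [x] along [v]. *)
  have dg : is_derive (0 : R) 1 (fun w : R => F (w *: v + x)) (dF j x).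
    have := @is_derive_line F (dF j) v x 0 (hF j).
    by rewrite scale0r add0r.
  have dhx : is_derive ((fun w : R => F (w *: v + x)) 0) 1 h (h' (F x)).
    by rewrite scale0r add0r; exact: dh.
  have [h1 h2] := is_derive1_comp dhx dg.
  have e : (fun k : R => k^-1 *: (((h \o (fun w : R => F (w *: v + x))) \o shift 0) (k *: (1:R))
     - (h \o (fun w : R => F (w *: v + x))) 0)) =
    (fun k : R => k^-1 *: (((h \o F) \o shift x) (k *: v) - (h \o F) x)).
    by apply/funext => k /=; rewrite [k%:A]mulr1 addr0 scale0r add0r.
  by split; [move: h1|move: h2]; rewrite /derivable /derive e.
Qed.

Lemma smooth_has_grad F : smooth F -> has_grad F (fun j => partial j F).
Proof.
move=> sF; split.
- by have [] := sF [::].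
- by move=> j; have [] := sF [:: j].
- move=> j x; have [_ h] := sF [::].
  by apply: derivableP; exact: h.
Qed.

Lemma smooth_partial F j : smooth F -> smooth (partial j F).
Proof.
by move=> sF s; have := sF (rcons s j); rewrite /iter_partial foldr_rcons.
Qed.

(** * Functions supported in a cube, and the vanishing of integrals of their derivatives *)

Definition off_box (N : R) F := forall x, (exists i, N < `|x 0 i|) -> F x = 0.

(** The complement of the closed cube is open, so [F] agrees with [0] near each of its points. *)
Lemma off_box_grad N F dF j : has_grad F dF -> off_box N F -> off_box N (dF j).
Proof.
move=> [_ _ h] F0 x [i xi].
have e : \near x, (fun=> 0 : R) x = F x.
  have ci : {for x, continuous (fun y : E => `|y 0 i|)}.
    apply: continuous_comp; first exact: coord_continuous.
    exact: norm_continuous.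
  have : \forall y \near x, N < `|(y : E) 0 i|.
    exact: (cvgr_gt _ ci).
  by apply: filterS => y yN; rewrite F0//; exists i.
have := near_eq_is_derive e (is_derive_cst (0:R) x (delta_mx 0 j)).
by apply: is_derive_unique; exact: h.
Qed.

Lemma off_box_bounded N F : continuous F -> off_box N F -> exists M, forall x, `|F x| <= M.
Proof.
move=> cF F0.
have K : compact [set v : E | forall i, `[(- N), N]%classic (v ord0 i)].
  by apply: (@rV_compact _ _ (fun=> `[(- N), N]%classic)) => i; exact: segment_compact.
have := continuous_compact (continuous_subspaceT cF) K.
move=> /compact_bounded[M [_ hM]].
exists (`|M| + 1) => x.
have [h|] := pselect (forall i, `|x 0 i| <= N).
  apply: hM; first by rewrite (le_lt_trans (ler_norm _))// ltrDl.
  by exists x => // i; rewrite /= in_itv/= -ler_norml.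
move=> /existsNP[i /negP]; rewrite -ltNge => xi.
by rewrite F0 ?normr0 ?addr_ge0//; exists i.
Qed.

Lemma off_box_row N F (t : d.-tuple T) : off_box N F -> ~ box N t -> F (row_of t) = 0.
Proof.
move=> F0 /existsNP[i /negP]; rewrite -ltNge => ti.
by apply: F0; exists i; rewrite mxE.
Qed.

Lemma off_box_integrable N F : continuous F -> off_box N F ->
  (lebesgue_tuple d).-integrable [set: d.-tuple T] (EFin \o (F \o row_of)).
Proof.
move=> cF F0; have [M FM] := off_box_bounded cF F0.
apply: (@integrable_tuple _ _ _ N M).
- exact: continuous_measurable_row.
- by move=> t; exact: FM.
- by move=> t; exact: off_box_row.
Qed.

Lemma row_of_upd (t : d.-tuple R) j w :
  row_of (upd t j w) = w *: delta_mx 0 j + row_of (upd t j 0).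
Proof.
apply/rowP => i; rewrite !mxE !tnth_mktuple/=.
by case: eqP => _; rewrite ?mulr1 ?addr0 ?mulr0 ?add0r.
Qed.

Lemma integral_grad_eq0 N F dF j : has_grad F dF -> off_box N F ->
  (\int[lebesgue_tuple d]_(t in [set: d.-tuple T]) (dF j (row_of t))%:E = 0)%E.
Proof.
move=> hF F0; have dF0 := off_box_grad j hF F0; case: hF => cF cdF h.
have [M dFM] := off_box_bounded (cdF j) dF0.
apply: (@integral_tuple_deriv_eq0 _ _ j (F \o row_of) _ N M).
- exact: (continuous_measurable_row (cdF j)).
- by move=> t; exact: dFM.
- by move=> t tN; split; [exact: off_box_row tN|exact: off_box_row tN].
- move=> t u.
  rewrite (_ : (fun w => _) = (fun w : R => F (w *: delta_mx 0 j + row_of (upd t j 0)))).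
    by rewrite (row_of_upd t j u); exact: (@is_derive_line F (dF j) _ _ u (h j)).
  by apply/funext => w /=; rewrite row_of_upd.
- move=> t; rewrite (_ : (fun u => _) =
    dF j \o (fun u : R => u *: delta_mx 0 j + row_of (upd t j 0))); last first.
    by apply/funext => w /=; rewrite row_of_upd.
  move=> u; apply: continuous_comp; last exact: cdF.
  apply: cvgD; last exact: cst_continuous.
  exact: scalel_continuous.
Qed.

End calculus.

(** * The radial weights *)

Section scalar.
Context {R : realType}.
Implicit Types (a m s t eta tau delta p l : R).

(** The weight of the theorem as a function of [s = |x|^2]: all scalar estimates are stated in terms
    of squared distances. *)
Definition rho s : R := 1 / (1 + s * ln (Num.sqrt s) ^+ 2).

Lemma rho_ge0 s : 0 <= s -> 0 <= rho s.
Proof. by move=> s0; rewrite divr_ge0// addr_ge0// mulr_ge0// sqr_ge0. Qed.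

Lemma rho_le1 s : 0 <= s -> rho s <= 1.
Proof.
move=> s0; have h : 0 <= s * ln (Num.sqrt s) ^+ 2 by rewrite mulr_ge0// sqr_ge0.
by rewrite ler_pdivrMr; [rewrite mul1r lerDl|rewrite ltr_pwDl].
Qed.

(** The shifts keep this logarithm at least [1] for [t >= 0], hence safe to divide by; with
    [t = |x - z|^2] it behaves like [2 log |x|] at infinity. *)
Definition log_denom t : R := 1 + ln (1 + t).

Lemma log_denom_ge1 t : 0 <= t -> 1 <= log_denom t.
Proof. by move=> t0; rewrite lerDl ln_ge0// lerDl. Qed.

Lemma log_denom_le t : 0 <= t -> log_denom t <= 1 + t.
Proof. by move=> t0; rewrite lerD2l le_ln1Dx// (lt_le_trans _ t0)// ltrN10. Qed.

(** Transfers the weight from the origin to a centre [z] with [m = |z|^2]. For [s <= S] the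
    denominator on the right is at most [A1]. For [s > S] the quantity [u = ln s / 2] is at least
    [1] and absorbs every additive constant, so that [log_denom t <= (k + 4) * u]. *)
Lemma rho_log_denom m : 0 <= m -> exists2 c : R, 0 < c &
  forall s t, 0 <= s -> 0 <= t -> t <= 2 * s + 2 * m ->
    c * rho s <= 1 / ((1 + t) * log_denom t ^+ 2).
Proof.
move=> m0; pose K : R := 2 * m + 2; have K2 : 2 <= K by rewrite /K; lra.
pose k : R := 1 + ln K; have k1 : 1 <= k by rewrite lerDl ln_ge0; lra.
(* The threshold [e^2] serves twice: beyond it [1 <= u], and, being at least [3], it gives
   [1 + s <= s ^+ 2]. *)
pose S : R := expR 2; have S3 : 3 <= S by have := expR_ge1Dx (2:R); rewrite /S; lra.
pose A1 := (K * (1 + S)) ^+ 3; pose A2 := 2 * K * (k + 4) ^+ 2.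
have A10 : 0 < A1 by rewrite exprn_gt0// mulr_gt0; lra.
have A20 : 0 < A2 by rewrite mulr_gt0 ?exprn_gt0; lra.
exists (1 / (A1 + A2)); first by rewrite divr_gt0// addr_gt0.
move=> s t s0 t0 ts; set u := ln (Num.sqrt s).
have su0 : 0 <= s * u ^+ 2 by rewrite mulr_ge0// sqr_ge0.
have l1 := log_denom_ge1 t0; have ll := log_denom_le t0.
have tK : 1 + t <= K * (1 + s) by rewrite /K; nra.
have D0 : 0 < (1 + t) * log_denom t ^+ 2 by rewrite mulr_gt0 ?exprn_gt0//; lra.
suff h : (1 + t) * log_denom t ^+ 2 <= (A1 + A2) * (1 + s * u ^+ 2).
  rewrite /rho -/u mulrACA mulr1 -invfM !mul1r lef_pV2 ?posrE//.
  by rewrite mulr_gt0//; lra.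
apply: (@le_trans _ _ (A1 + A2 * (s * u ^+ 2))); last by nra.
have [sS|Ss] := leP s S.
  suff : (1 + t) * log_denom t ^+ 2 <= A1.
    have : 0 <= A2 * (s * u ^+ 2) by rewrite mulr_ge0// ltW.
    lra.
  have KS : 1 + t <= K * (1 + S) by apply: le_trans tK _; rewrite ler_wpM2l; lra.
  rewrite /A1 [leRHS]exprS; apply: ler_pM => //; [lra|exact: sqr_ge0|].
  rewrite ler_pXn2r// ?nnegrE; lra.
suff : (1 + t) * log_denom t ^+ 2 <= A2 * (s * u ^+ 2) by lra.
have s1 : 0 < s by lra.
have q0 : 0 < Num.sqrt s by rewrite sqrtr_gt0.
have lns : ln s = 2 * u by rewrite -[in LHS](@sqr_sqrtr _ s)// lnXn// mulr2n /u; lra.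
have u1 : 1 <= u.
  have : ln S <= ln s by rewrite ler_ln ?posrE ?expR_gt0// ltW.
  by rewrite /S expRK lns; lra.
have lu : log_denom t <= (k + 4) * u.
  have h1 : ln (1 + t) <= ln (K * (1 + s)).
    by rewrite ler_ln ?posrE//; nra.
  have h2 : ln (K * (1 + s)) = ln K + ln (1 + s) by rewrite lnM ?posrE//; lra.
  have h3 : ln (1 + s) <= ln (s ^+ 2).
    by rewrite ler_ln ?posrE ?exprn_gt0//; nra.
  have h4 : ln (s ^+ 2) = 4 * u by rewrite lnXn// mulr2n lns; lra.
  have h5 : k <= k * u by nra.
  rewrite /log_denom; move: h5; rewrite /k; lra.
have ts2 : 1 + t <= 2 * K * s by apply: le_trans tK _; nra.
have -> : A2 * (s * u ^+ 2) = (2 * K * s) * ((k + 4) * u) ^+ 2.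
  by rewrite /A2; ring.
apply: ler_pM => //; [lra|exact: sqr_ge0|].
rewrite ler_pXn2r// ?nnegrE; [lra|nra].
Qed.

(** This is [(s + eta)^a (t + delta)^(-(a+1)) / log_denom t], with real exponents. The gradient of
    the first factor cancels the term [2 V . F]; since [a + 1 = d / 2], the second makes the field
    [x - z] divergence-free up to an error carried by [delta]; the decay of the last produces the
    positive potential. *)
Definition log_weight a delta s t eta : R :=
  expR (a * ln (s + eta) - (a + 1) * ln (t + delta)) / log_denom t.

(* [div F - 2 V . F] for the field [F = - log_weight (x - z)], where [s] and [t]
   are the squared distances of [x] to the origin and to [z]. *)
Definition log_potential a delta s t eta : R :=
  log_weight a delta s t eta *
  (2 * t / ((1 + t) * log_denom t) - 2 * (a + 1) * delta / (t + delta)).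

(* A lower bound of [div F - 2 V . F] for [F = origin_weight x] is
   [origin_potential]. *)
Definition origin_weight s : R := (1 + s) ^- 3.

Definition origin_potential s : R := 2 * (1 - 2 * s) / (1 + s) ^+ 4.

(** With [z = 1 / (1 + s)] one has [s z = 1 - z], and each claim becomes a polynomial inequality for
    [z] in []0, 1]]. For [s <= 1 / 4], [z >= 4 / 5] and the potential is [z^3 (6 z - 4)]. *)
Lemma origin_weight_bounds s : 0 <= s ->
  [/\ origin_weight s ^+ 2 * s <= (1 + s) ^- 3, origin_weight s ^+ 2 * s <= 1,
   - 4 * (1 + s) ^- 3 <= origin_potential s & s <= 1 / 4 -> 2 / 5 <= origin_potential s].
Proof.
move=> s0; rewrite /origin_weight /origin_potential; set z := (1 + s)^-1.
have z0 : 0 < z by rewrite invr_gt0; lra.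
have z1 : z <= 1 by rewrite invf_le1; lra.
have zs : z * (1 + s) = 1 by rewrite mulVf//; lra.
have e : s = z^-1 - 1 by rewrite invrK; lra.
have sz : s * z = 1 - z by lra.
rewrite -!exprVn -/z.
have z3 : 0 < z ^+ 3 by exact: exprn_gt0.
have z31 : z ^+ 3 <= 1 by rewrite exprn_ile1// ltW.
have -> : (z ^+ 3) ^+ 2 * s = z ^+ 3 * (z ^+ 2 * (1 - z)) by rewrite -sz; ring.
have h : 0 <= z ^+ 2 * (1 - z) <= 1 by rewrite mulr_ge0 ?sqr_ge0//=; nra.
have -> : 2 * (1 - 2 * s) * z ^+ 4 = z ^+ 3 * (2 * z - 4 * (1 - z)).
  by rewrite -sz; ring.
split; [nra|nra|nra|] => s4.
have z45 : 4 / 5 <= z by nra.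
have : (4 / 5) ^+ 3 <= z ^+ 3 by rewrite ler_pXn2r// ?nnegrE; lra.
nra.
Qed.

Lemma expR_ln_ratio_le a q x y : 0 <= a -> 0 < q -> 0 < x -> 0 < y -> x <= q * y ->
  expR (a * (ln x - ln y)) <= expR (a * ln q).
Proof.
move=> a0 q0 x0 y0 xy; rewrite ler_expR; apply: ler_wpM2l => //.
by rewrite -ln_div ?posrE// ler_ln ?posrE// ?divr_gt0// ler_pdivrMr.
Qed.

Lemma expR_ln_ratio_ge a q x y : 0 <= a -> 0 < q -> 0 < x -> 0 < y -> q * y <= x ->
  expR (a * ln q) <= expR (a * (ln x - ln y)).
Proof.
move=> a0 q0 x0 y0 xy; rewrite ler_expR; apply: ler_wpM2l => //.
by rewrite -ln_div ?posrE// ler_ln ?posrE// ?divr_gt0// ler_pdivlMr.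
Qed.

(* Here [E] stands for the weight, [p] for the power of [(s + eta) / (t + delta)]
   it contains, and [l] for the logarithmic factor. *)
Lemma log_weight_core b tau delta K P0 p0 s t l p :
  2 <= b -> 0 < delta <= 1 -> 1 <= K -> b * K ^+ 2 * delta = 1 ->
  0 <= t -> 1 <= l -> l <= 1 + t -> 0 < p <= P0 -> 0 < p0 ->
  (tau <= t -> 1 + t <= K * t) -> (1 / 4 <= s -> p0 <= p) ->
  let E := p / (t + delta) / l in
  let L := E * (2 * t / ((1 + t) * l) - b * delta / (t + delta)) in
  let P := P0 / delta + b * (P0 / delta) in
  [/\ 0 < E <= P, tau <= t -> 0 <= L, tau <= t -> E ^+ 2 * t <= P0 * K * L,
    tau <= t -> 1 / 4 <= s -> p0 / K * (1 / ((1 + t) * l ^+ 2)) <= L & - P <= L].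
Proof.
move=> b2 /andP[d0 d1] K1 dK t0 l1 ll /andP[p_gt0 pP] p00 tK pp0 E L P.
have td0 : 0 < t + delta by exact: ltr_wpDl.
have l0 : 0 < l by exact: lt_le_trans l1.
have tl0 : 0 < (1 + t) * l by rewrite mulr_gt0// ltr_wpDr.
have P00 : 0 < P0 by exact: lt_le_trans pP.
have b0 : 0 <= b by exact: le_trans b2.
have K0 : 0 < K by exact: lt_le_trans K1.
have E0 : 0 < E by rewrite /E !divr_gt0.
have Ed : E <= P0 / delta.
  rewrite /E -mulrA; apply: ler_pM; rewrite ?(ltW p_gt0) ?pP//.
    by rewrite divr_ge0 ?invr_ge0 ?(ltW td0) ?(ltW l0).
  rewrite -invfM lef_pV2 ?posrE ?mulr_gt0//.
  by clear -d0 t0 l1; nra.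
(* Gain and loss: [L = E * (2 * X - Y)]. Away from [z] one copy of [X] pays for [Y], which leaves
   [E * X <= L]. *)
pose X := t / ((1 + t) * l); pose Y := b * delta / (t + delta).
have LE : L = E * (2 * X - Y) by rewrite /L /X mulrA.
have X0 : 0 <= X by rewrite /X divr_ge0 ?(ltW tl0).
have Y0 : 0 <= Y by rewrite /Y divr_ge0 ?(ltW td0)// mulr_ge0// ltW.
(* Here the normalisation of [delta] enters: [b delta (1 + t) l <= b delta (K t)^2 = t^2 <= t (t +
   delta)]. *)
have YX : tau <= t -> Y <= X.
  move=> /tK {}tK; rewrite /Y /X ler_pdivrMr// [leRHS]mulrAC ler_pdivlMr//.
  apply: (@le_trans _ _ (t * t)); last by rewrite ler_wpM2l// lerDl ltW.
  apply: (@le_trans _ _ (b * delta * ((K * t) * (K * t)))).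
    rewrite ler_wpM2l ?mulr_ge0 ?(ltW d0)//.
    by clear -tK ll l1 t0; nra.
  have -> : b * delta * (K * t * (K * t)) = (b * K ^+ 2 * delta) * (t * t) by ring.
  by rewrite dK mul1r.
have KX : tau <= t -> K^-1 / l <= X.
  move=> /tK {}tK; rewrite /X invfM mulrA; apply: ler_wpM2r.
    by rewrite invr_ge0 ltW.
  by rewrite ler_pdivlMr ?ltr_wpDr// ler_pdivrMl.
have EXL : tau <= t -> E * X <= L.
  move=> /YX {}YX; rewrite LE ler_wpM2l ?(ltW E0)//.
  by clear -YX; lra.
split.
- rewrite E0/=; apply: le_trans Ed _; rewrite lerDl mulr_ge0// divr_ge0//; exact: ltW.
- by move=> /EXL; apply: le_trans; rewrite mulr_ge0// ltW.
- move=> taut; apply: (@le_trans _ _ (P0 * K * (E * X))); last first.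
    by rewrite ler_wpM2l ?EXL// mulr_ge0// ltW.
  have -> : E ^+ 2 * t = E * (p * (t / (t + delta) / l)).
    by rewrite expr2 -mulrA; congr (_ * _); rewrite /E; clear; ring.
  have -> : P0 * K * (E * X) = E * (P0 * (K * X)) by clear; ring.
  rewrite ler_wpM2l ?(ltW E0)//; apply: ler_pM; rewrite ?(ltW p_gt0)//.
    by rewrite !divr_ge0 ?(ltW td0) ?(ltW l0).
  apply: (@le_trans _ _ (1 / l)).
    by rewrite ler_wpM2r ?invr_ge0 ?(ltW l0)// ler_pdivrMr// mul1r lerDl ltW.
  by rewrite -ler_pdivrMl// mul1r KX.
- move=> taut /pp0 {}pp0; apply: le_trans (EXL taut).
  apply: (@le_trans _ _ (E * (K^-1 / l))); last by rewrite ler_wpM2l ?KX ?(ltW E0).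
  have EL : p0 / (1 + t) / l <= E.
    rewrite /E ler_wpM2r ?invr_ge0 ?(ltW l0)//.
    apply: ler_pM; rewrite ?(ltW p00) ?invr_ge0 ?addr_ge0//.
    have h : t + delta <= 1 + t by clear -d1; lra.
    by rewrite lef_pV2 ?posrE// ltr_wpDr.
  rewrite (_ : p0 / K * _ = p0 / (1 + t) / l * (K^-1 / l)).
    by rewrite ler_wpM2r// divr_ge0 ?invr_ge0 ?(ltW K0) ?(ltW l0).
  have ? : 1 + t != 0 by rewrite gt_eqF// ltr_wpDr.
  have ? : l != 0 by rewrite gt_eqF.
  have ? : K != 0 by rewrite gt_eqF.
  by field; apply/and3P.
- have Y1 : Y <= b by rewrite /Y ler_pdivrMr// ler_wpM2l// lerDr.
  have EY : E * Y <= P0 / delta * b by apply: ler_pM; rewrite ?(ltW E0).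
  have EX : 0 <= E * (2 * X) by rewrite mulr_ge0 ?(ltW E0)// mulr_ge0.
  have PD : 0 <= P0 / delta by rewrite divr_ge0// ltW.
  rewrite LE mulrBr /P; clear -EY EX PD; lra.
Qed.

(** The constants are chosen before [eta]. The quantitative lower bound is limited to [s >= 1 / 4]
    because the factor [(s + eta)^a] of the weight may degenerate at the origin as [eta] tends to
    [0]. *)
Lemma log_weight_bounds a m tau : 0 <= a -> 0 <= m -> 0 < tau ->
  exists delta P K c1 : R, [/\ 0 < delta <= 1, 0 < P, 0 < K, 0 < c1 &
  forall s t eta, 0 < eta <= 1 -> 0 <= s -> 0 <= t ->
    s <= 2 * t + 2 * m -> t <= 2 * s + 2 * m ->
    [/\ 0 < log_weight a delta s t eta <= P,
      tau <= t -> 0 <= log_potential a delta s t eta,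
      tau <= t -> log_weight a delta s t eta ^+ 2 * t <= K * log_potential a delta s t eta,
      tau <= t -> 1 / 4 <= s -> c1 * (1 / ((1 + t) * log_denom t ^+ 2)) <= log_potential a delta s t eta &
      - P <= log_potential a delta s t eta]].
Proof.
move=> a0 m0 tau0; pose K := 1 + tau^-1.
have tV : 0 < tau^-1 by rewrite invr_gt0.
have K1 : 1 <= K by rewrite lerDl ltW.
have K0 : 0 < K by exact: lt_le_trans K1.
have tK t : tau <= t -> 1 + t <= K * t.
  by move=> tt; rewrite /K mulrDl mul1r addrC lerD2l ler_pdivlMl// mulr1.
have b2 : 2 <= 2 * (a + 1) by rewrite ler_peMr// lerDr.
pose delta := (2 * (a + 1) * K ^+ 2)^-1.
have dV0 : 0 < 2 * (a + 1) * K ^+ 2 by rewrite mulr_gt0 ?exprn_gt0// (lt_le_trans _ b2).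
have d0 : 0 < delta by rewrite invr_gt0.
have dK : 2 * (a + 1) * K ^+ 2 * delta = 1 by rewrite mulfV// gt_eqF.
have d1 : delta <= 1.
  rewrite invf_le1//; apply: (@le_trans _ _ (2 * (a + 1))).
    by apply: le_trans b2; rewrite ler1n.
  by rewrite ler_peMr ?exprn_ege1// (le_trans _ b2).
(* [Q] bounds [(s + eta) / (t + delta)] from above; the reciprocal of [8 * m + 6] bounds it from
   below once [s >= 1 / 4]. *)
pose Q := (2 * m + 3) / delta.
have m3 : 0 < 2 * m + 3 by rewrite ltr_wpDl// mulr_ge0.
have Q0 : 0 < Q by rewrite divr_gt0.
have P00 : 0 < expR (a * ln Q) by exact: expR_gt0.
have PD0 : 0 < expR (a * ln Q) / delta by exact: divr_gt0.
have p00 : 0 < expR (a * ln (8 * m + 6)^-1) by exact: expR_gt0.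
exists delta, (expR (a * ln Q) / delta + 2 * (a + 1) * (expR (a * ln Q) / delta)),
  (expR (a * ln Q) * K), (expR (a * ln (8 * m + 6)^-1) / K); split.
- by rewrite d0.
- by rewrite addr_gt0// mulr_gt0// (lt_le_trans _ b2).
- by rewrite mulr_gt0.
- by rewrite divr_gt0.
move=> s t eta /andP[eta0 eta1] s0 t0 st ts.
have td0 : 0 < t + delta by exact: ltr_wpDl.
have se0 : 0 < s + eta by exact: ltr_wpDl.
pose p := expR (a * (ln (s + eta) - ln (t + delta))).
have EE : log_weight a delta s t eta = p / (t + delta) / log_denom t.
  rewrite /log_weight /p; congr (_ / _).
  have -> : a * ln (s + eta) - (a + 1) * ln (t + delta) =
      a * (ln (s + eta) - ln (t + delta)) - ln (t + delta) by clear; ring.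
  by rewrite expRB lnK ?posrE.
rewrite /log_potential EE; apply: log_weight_core => //.
- by rewrite d0.
- exact: log_denom_ge1.
- exact: log_denom_le.
- rewrite expR_gt0/=; apply: expR_ln_ratio_le => //.
  rewrite /Q mulrAC ler_pdivlMr//.
  by clear -st eta0 eta1 d0 d1 t0 s0 m0; nra.
- exact: tK.
- move=> s4; have m6 : 0 < 8 * m + 6 by rewrite ltr_wpDl// mulr_ge0.
  apply: expR_ln_ratio_ge => //; first by rewrite invr_gt0.
  rewrite ler_pdivrMl//.
  by clear -ts s4 eta0 d1 m0; nra.
Qed.

(** Away from both centres the logarithmic potential [L] dominates: the negative part of the origin
    potential costs at most [L / 2], the quadratic terms at most another [L / 4], and a quarter of
    [L] remains. *)
Lemma weight_core_far eps kappa g K L l2 w z X y :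
  0 < eps -> 0 <= kappa -> 0 < g -> kappa * 8 <= g ->
  eps * (K + kappa ^+ 2 / g) * 8 <= 1 ->
  0 <= L -> 0 <= z -> g * z <= L -> - 4 * z <= l2 -> w <= z -> X <= K * L ->
  y <= eps / 4 * L ->
  y <= eps * (L + kappa * l2) - 2 * eps ^+ 2 * (X + kappa ^+ 2 * w).
Proof.
move=> e0 k0 g0 kg eM L0 z0 gz l2z wz XK yL.
have h1 : - (L / 2) <= kappa * l2.
  have a1 := ler_wpM2l k0 l2z; have a2 := ler_wpM2r z0 kg.
  by clear -a1 a2 gz; lra.
have h2 : kappa ^+ 2 * w <= kappa ^+ 2 / g * L.
  apply: (@le_trans _ _ (kappa ^+ 2 / g * (g * z))).
    by rewrite mulrA divfK ?gt_eqF// ler_wpM2l// sqr_ge0.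
  by rewrite ler_wpM2l// divr_ge0 ?sqr_ge0// ltW.
have h3 : X + kappa ^+ 2 * w <= (K + kappa ^+ 2 / g) * L by rewrite mulrDl lerD.
have h4 := ler_wpM2l (ltW e0) h3; have h5 := ler_wpM2r L0 eM.
have h6 : L / 4 <= L + kappa * l2 - 2 * (eps * (X + kappa ^+ 2 * w)).
  by clear -h1 h4 h5; lra.
have := ler_wpM2l (ltW e0) h6; clear -yL; lra.
Qed.

(** Near the origin [L] is only known to be nonnegative, and the origin potential, at least [2 / 5],
    supplies the gain; [kappa / 5] survives the quadratic terms. *)
Lemma weight_core_origin eps kappa K L l2 w X y :
  0 < eps -> 0 <= kappa -> kappa <= 1 -> eps * 10 <= 1 -> eps * K * 8 <= 1 ->
  0 <= L -> 2 / 5 <= l2 -> w <= 1 -> X <= K * L -> y <= eps * kappa / 5 ->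
  y <= eps * (L + kappa * l2) - 2 * eps ^+ 2 * (X + kappa ^+ 2 * w).
Proof.
move=> e0 k0 k1 e10 eK L0 l25 w1 XK yk.
have h1 := ler_wpM2l k0 l25.
have h2 : kappa ^+ 2 * w <= kappa.
  apply: (@le_trans _ _ (kappa ^+ 2)); first by rewrite ler_piMr// sqr_ge0.
  by rewrite expr2 ler_piMr.
have h3 := ler_wpM2l (ltW e0) XK; have h4 := ler_wpM2r L0 eK.
have h5 := ler_wpM2l (ltW e0) h2; have h6 := ler_wpM2r k0 e10.
have h7 : kappa / 5 <= L + kappa * l2 - 2 * (eps * X + eps * (kappa ^+ 2 * w)).
  by clear -h1 h3 h4 h5 h6 L0 k0; lra.
have := ler_wpM2l (ltW e0) h7; clear -yk; lra.
Qed.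

(** Near [z] no sign is available, and all terms are merely bounded; the subtracted constant becomes
    the loss [C] of [weight_inequality]. *)
Lemma weight_core_near eps kappa tau P L l2 w E t y c :
  0 <= eps -> 0 <= kappa -> 0 <= t -> t <= tau -> 0 <= E -> E <= P -> - P <= L ->
  - 4 <= l2 -> w <= 1 -> y <= c ->
  y - (c + eps * (P + 4 * kappa) + 2 * eps ^+ 2 * (P ^+ 2 * tau + kappa ^+ 2)) <=
  eps * (L + kappa * l2) - 2 * eps ^+ 2 * (E ^+ 2 * t + kappa ^+ 2 * w).
Proof.
move=> e0 k0 t0 tt E0 EP PL l24 w1 yc.
have e2 : 0 <= 2 * eps ^+ 2 by rewrite mulr_ge0// sqr_ge0.
have P0 : 0 <= P by exact: le_trans EP.
have h1 : E ^+ 2 * t <= P ^+ 2 * tau.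
  by apply: ler_pM; rewrite ?sqr_ge0// ler_pXn2r ?nnegrE.
have h2 : kappa ^+ 2 * w <= kappa ^+ 2 by rewrite ler_piMr// sqr_ge0.
have h3 := ler_wpM2l e2 h1; have h4 := ler_wpM2l e2 h2.
have h6 := ler_wpM2l k0 l24.
have h7 : - (P + 4 * kappa) <= L + kappa * l2 by clear -h6 PL; lra.
have := ler_wpM2l e0 h7; clear -yc h3 h4; lra.
Qed.

(** Three regions, one for each lemma above: [t < tau], then [t >= tau] with [s >= 1 / 4], and with
    [s < 1 / 4]. The constants are fixed in the order [kappa], [eps], [c], each small with respect
    to the earlier ones, and none depends on [eta]. *)
Lemma weight_inequality a m tau : 0 <= a -> 0 <= m -> 0 < tau ->
  exists delta kappa eps c C : R,
  [/\ 0 < delta, 0 <= kappa, 0 <= eps, 0 < c & 0 <= C] /\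
  forall s t eta, 0 < eta <= 1 -> 0 <= s -> 0 <= t ->
    s <= 2 * t + 2 * m -> t <= 2 * s + 2 * m ->
    c * rho s - (if tau <= t then 0 else C) <=
      eps * (log_potential a delta s t eta + kappa * origin_potential s)
      - 2 * eps ^+ 2 * (log_weight a delta s t eta ^+ 2 * t + kappa ^+ 2 * (origin_weight s ^+ 2 * s)).
Proof.
move=> a0 m0 tau0.
have [delta [P [K [c1 [/andP[d0 _] P0 K0 c10 H]]]]] := log_weight_bounds a0 m0 tau0.
have [c2 c20 Hrho] := rho_log_denom m0.
have m2 : 0 < 2 * m + 2 by rewrite ltr_wpDl// mulr_ge0.
(* Comes from [(1 + t) * log_denom t ^+ 2 <= (1 + t)^3 <= (2 m + 2)^3 (1 + s)^3], which compares the
   origin terms with the logarithmic weight. *)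
pose c3 : R := (2 * m + 2) ^- 3; have c30 : 0 < c3 by rewrite invr_gt0 exprn_gt0.
have [g [gE g0]] : exists g, g = c1 * c3 /\ 0 < g by exists (c1 * c3); rewrite mulr_gt0.
have [kappa [k0 k1 kg]] : exists kappa, [/\ 0 < kappa, kappa <= 1 & kappa * 8 <= g].
  have D0 : 0 < 8 + g by rewrite ltr_wpDl.
  exists (g / (8 + g)); split; first by rewrite divr_gt0.
    by rewrite ler_pdivrMr// mul1r lerDr.
  by rewrite mulrAC ler_pdivrMr// ler_wpM2l ?(ltW g0)// lerDl ltW.
have kk0 : 0 <= kappa ^+ 2 / g by rewrite divr_ge0 ?sqr_ge0// ltW.
have [eps [e0 e10 eM]] : exists eps : R,
    [/\ 0 < eps, eps * 10 <= 1 & eps * (K + kappa ^+ 2 / g) * 8 <= 1].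
  have M0 : 0 <= K + kappa ^+ 2 / g by rewrite addr_ge0// ltW.
  move: (K + _) M0 => M M0.
  have D0 : 0 < 10 + 8 * M by clear -M0; lra.
  exists (10 + 8 * M)^-1; split; first by rewrite invr_gt0.
    by rewrite mulrC ler_pdivrMr// mul1r; clear -M0; lra.
  by rewrite -mulrA mulrC ler_pdivrMr// mul1r; clear -M0; lra.
have eK : eps * K * 8 <= 1.
  by apply: le_trans eM; rewrite ler_pM2r// ler_pM2l// lerDl.
have [c [c0 cA cB]] : exists c, [/\ 0 < c, c <= eps / 4 * (c1 * c2) & c <= eps * kappa / 5].
  exists (Num.min (eps / 4 * (c1 * c2)) (eps * kappa / 5)).
  rewrite !ge_min !lexx ?orbT lt_min.
  by rewrite !(mulr_gt0, divr_gt0).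
exists delta, kappa, eps, c,
  (c + eps * (P + 4 * kappa) + 2 * eps ^+ 2 * (P ^+ 2 * tau + kappa ^+ 2)); split.
  split=> //; rewrite ?(ltW k0) ?(ltW e0)//.
  by rewrite !addr_ge0// ?mulr_ge0 ?addr_ge0 ?mulr_ge0 ?sqr_ge0//; exact: ltW.
move=> s t eta eta01 s0 t0 st ts.
have [/andP[E0 EP] L0 E2 L1 LP] := H s t eta eta01 s0 t0 st ts.
have [w3 w1 l2 l25] := origin_weight_bounds s0.
have rh0 := rho_ge0 s0; have rh1 := rho_le1 s0.
have cr : c * rho s <= c by rewrite ler_piMr// ltW.
have s1 : 1 <= 1 + s by rewrite lerDl.
have s10 : 0 < 1 + s by exact: lt_le_trans s1.
case: ifPn => [taut|]; last first.
  have l24 : - 4 <= origin_potential s.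
    apply: le_trans l2; rewrite mulNr lerN2 ger_pMr//.
    by rewrite invf_le1 ?exprn_gt0 ?exprn_ege1.
  by rewrite -ltNge => tt; apply: weight_core_near => //; exact: ltW.
rewrite subr0; have {}L0 := L0 taut; have {}E2 := E2 taut.
have [s4|s4] := leP (1 / 4) s.
- have {}L1 := L1 taut s4.
  apply: (@weight_core_far _ _ g K _ _ _ ((1 + s) ^- 3)) => //.
  + exact: ltW.
  + by rewrite invr_ge0 exprn_ge0// ltW.
  + apply: le_trans L1; rewrite gE -mulrA ler_pM2l//.
    have l1 := log_denom_ge1 t0; have ll := log_denom_le t0.
    have l0 : 0 < log_denom t by exact: lt_le_trans l1.
    have t1 : 0 < 1 + t by rewrite ltr_wpDr.
    rewrite /c3 -invfM -exprMn mul1r lef_pV2 ?posrE ?mulr_gt0 ?exprn_gt0 ?mulr_gt0//.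
    apply: (@le_trans _ _ ((1 + t) ^+ 3)).
      by rewrite [leRHS]exprS ler_pM2l// ler_pXn2r ?nnegrE// ltW.
    rewrite ler_pXn2r ?nnegrE ?mulr_ge0 ?(ltW t1) ?(ltW m2) ?(ltW s10)//.
    have ms := mulr_ge0 m0 s0; clear -ts ms s0; lra.
  + apply: (@le_trans _ _ (eps / 4 * (c1 * c2) * rho s)); first by rewrite ler_wpM2r.
    rewrite -mulrA ler_pM2l ?divr_gt0// -mulrA; apply: le_trans L1.
    by rewrite ler_pM2l// Hrho.
- apply: (@weight_core_origin _ _ K) => //.
  + exact: ltW.
  + by rewrite l25// ltW.
  + exact: le_trans cB.
Qed.

End scalar.

(** * Symmetry of mixed partial derivatives and the cutoff *)

Section mixed_partials.
Local Open Scope classical_set_scope.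
Context {R : realType} {d : nat}.
Local Notation E := 'rV[R]_d.
Local Notation e j := (delta_mx 0 j : E).
Implicit Types (F : E -> R) (dF : 'I_d -> E -> R).

(** The mean value theorem twice: in direction [j] for the difference [P], then in direction [k] for
    [dF j]. *)
Lemma mixed_difference F dF ddF (j k : 'I_d) x (h : R) : has_grad F dF ->
  has_grad (dF j) ddF -> 0 < h ->
  exists a b : R, [/\ 0 < a < h, 0 < b < h &
   F (h *: e j + (h *: e k + x)) - F (h *: e k + x) - (F (h *: e j + x) - F x) =
   h ^+ 2 * ddF k (b *: e k + (a *: e j + x))].
Proof.
move=> [_ _ hF] [_ _ hdF] h0.
pose P (w : R) := F (w *: e j + (h *: e k + x)) - F (w *: e j + x).
have dP (w : R) : is_derive w 1 P
    (dF j (w *: e j + (h *: e k + x)) - dF j (w *: e j + x)).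
  have := @is_derive_line _ _ F (dF j) (e j) (h *: e k + x) w (hF j).
  have := @is_derive_line _ _ F (dF j) (e j) x w (hF j).
  by move=> ? ?; exact: is_deriveB.
have cP : {within `[0, h], continuous P}.
  apply: continuous_subspaceT => w; apply/differentiable_continuous/derivable1_diffP.
  by have [] := dP w.
have [a ah Pa] := MVT h0 (fun w _ => dP w) cP.
pose Q (w : R) := dF j (w *: e k + (a *: e j + x)).
have dQ (w : R) : is_derive w 1 Q (ddF k (w *: e k + (a *: e j + x))).
  exact: (@is_derive_line _ _ (dF j) (ddF k) (e k) (a *: e j + x) w (hdF k)).
have cQ : {within `[0, h], continuous Q}.
  apply: continuous_subspaceT => w; apply/differentiable_continuous/derivable1_diffP.
  by have [] := dQ w.
have [b bh Qb] := MVT h0 (fun w _ => dQ w) cQ.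
exists a, b; split; [by move: ah; rewrite in_itv|by move: bh; rewrite in_itv|].
move: Pa Qb; rewrite /P /Q !scale0r !add0r !subr0 => Pa Qb.
move: Pa; rewrite (addrCA (a *: e j)) Qb => Pa.
rewrite [RHS](_ : _ = ddF k (b *: e k + (a *: e j + x)) * h * h); last by ring.
rewrite -Pa; ring.
Qed.

(** Schwarz's theorem. The second difference is symmetric in [j] and [k], so the two mixed
    derivatives take a common value at points arbitrarily close to [x], and both are continuous. *)
Lemma has_grad_mixed F dF ddFj ddFk (j k : 'I_d) x : has_grad F dF ->
  has_grad (dF j) ddFj -> has_grad (dF k) ddFk -> ddFj k x = ddFk j x.
Proof.
move=> hF hj hk; have [_ cj _] := hj; have [_ ck _] := hk.
apply/eqP; rewrite -subr_eq0 -normr_le0; apply/ler_addgt0Pl => r r0; rewrite addr0.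
have r20 : 0 < r / 2 by rewrite divr_gt0.
have Hj : \forall y \near x, `|ddFj k x - ddFj k (y : E)| <= r / 2.
  by have /cvgrPdist_le := cj k x; apply.
have Hk : \forall y \near x, `|ddFk j x - ddFk j (y : E)| <= r / 2.
  by have /cvgrPdist_le := ck j x; apply.
have [h h0 hb] : exists2 h : R, 0 < h & forall (i l : 'I_d) (a b : R),
   0 < a < h -> 0 < b < h ->
   `|ddFj k x - ddFj k (b *: e l + (a *: e i + x))| <= r / 2 /\
   `|ddFk j x - ddFk j (b *: e l + (a *: e i + x))| <= r / 2.
  have [u /= u0 hu] := (nbhs_ballP x _).1 (filterI Hj Hk).
  exists (u / 2); first by rewrite divr_gt0.
  move=> i l a b /andP[a0 au] /andP[b0 bu].
  apply: hu; split => // i' l'; rewrite !mxE /ball/= distrC !addrA addrK.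
  have le1 (c c' : bool) (y : R) : 0 < y -> `|y * (c && c')%:R| <= y.
    by move=> y0; case: (c && c'); [rewrite mulr1 gtr0_norm|rewrite mulr0 normr0 ltW].
  apply: le_lt_trans (ler_normD _ _) _.
  apply: (@le_lt_trans _ _ (b + a)); first by apply: lerD; exact: le1.
  by clear -au bu; lra.
have [a [b [ah bh D1]]] := mixed_difference k x hF hj h0.
have [a' [b' [ah' bh' D2]]] := mixed_difference j x hF hk h0.
have eq : ddFj k (b *: e k + (a *: e j + x)) = ddFk j (b' *: e j + (a' *: e k + x)).
  have hn0 : h ^+ 2 != 0 by rewrite expf_neq0// gt_eqF.
  apply: (mulfI hn0); rewrite -D1 -D2.
  rewrite (addrCA (h *: e j)); ring.
have [h1 _] := hb j k a b ah bh; have [_ h2] := hb k j a' b' ah' bh'.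
rewrite (_ : _ - _ = (ddFj k x - ddFj k (b *: e k + (a *: e j + x)))
   - (ddFk j x - ddFk j (b' *: e j + (a' *: e k + x)))); last by rewrite eq; ring.
apply: le_trans (ler_normB _ _) _; clear -h1 h2; lra.
Qed.

End mixed_partials.

Section cutoff.
Local Open Scope classical_set_scope.
Context {R : realType}.

Definition pospart (z : R) : R := Num.max z 0.

Lemma pospart_ge0 z : 0 <= pospart z.
Proof. by rewrite le_max lexx orbT. Qed.

Lemma pospart_id z : 0 <= z -> pospart z = z.
Proof. by move=> z0; rewrite /pospart max_l. Qed.

Lemma pospart_eq0 z : z <= 0 -> pospart z = 0.
Proof. by move=> z0; rewrite /pospart max_r. Qed.

Lemma continuous_pospart : continuous pospart.
Proof.
move=> z; apply: (@continuous_max _ _ (fun x : R => x) (fun=> 0 : R)).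
  exact: cvg_id.
exact: cst_continuous.
Qed.

(** Squaring removes the corner of the positive part: at [0] the difference quotient is [pospart h],
    which tends to [0]. *)
Lemma is_derive_pospart_sqr (z : R) :
  is_derive z 1 (fun y => pospart y ^+ 2) (2 * pospart z).
Proof.
have [z0|z0|->] := ltgtP z 0.
- rewrite (pospart_eq0 (ltW z0)) mulr0.
  apply: (@near_eq_is_derive _ _ _ (fun=> 0)) _ (is_derive_cst _ _ _).
  have := lt_nbhsl z0; apply: filterS => y y0.
  by rewrite pospart_eq0 ?expr0n// ltW.
- rewrite (pospart_id (ltW z0)).
  have h : is_derive z 1 (fun y : R => y ^+ 2) (2 * z).
    rewrite (_ : (fun y => _) = (id : R -> R) * (id : R -> R)); last first.
      by apply/funext => y; rewrite expr2.
    by apply: is_derive_eq; rewrite /GRing.scale/= mulr1 -mulr2n mulr_natl.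
  apply: near_eq_is_derive h.
  have := lt_nbhsr z0; apply: filterS => y y0.
  by rewrite pospart_id// ltW.
- rewrite (pospart_eq0 (lexx 0)) mulr0.
  suff e : (fun h : R => h^-1 *: (((fun y => pospart y ^+ 2) \o shift 0) (h *: (1:R))
      - pospart 0 ^+ 2)) @ 0^' --> (0 : R).
    by split; [apply/cvg_ex; eexists; exact: e|exact/cvg_lim].
  have c0 : pospart h @[h --> 0^'] --> (0:R).
    have := @continuous_pospart 0; rewrite /continuous_at (pospart_eq0 (lexx 0)).
    by apply: cvg_trans; apply: cvg_app; exact: nbhs_dnbhs.
  apply: cvg_trans c0; apply: near_eq_cvg; near=> h.
  rewrite /= addr0 [h%:A]mulr1 (pospart_eq0 (lexx 0)) expr0n subr0 /GRing.scale/=.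
  have hn0 : h != 0 by near: h; exact: nbhs_dnbhs_neq.
  have [h0|h0] := leP h 0; first by rewrite pospart_eq0// expr0n mulr0.
  by rewrite pospart_id ?ltW// expr2 mulKf.
Unshelve. all: by end_near. Qed.

End cutoff.

(** * The vector fields *)

Section zero_mean.
Local Open Scope classical_set_scope.
Context {R : realType} {d : nat}.
Local Notation T := (measurableTypeR R).
Local Notation E := 'rV[R]_d.
Implicit Types (F G : E -> R) (dF : 'I_d -> E -> R) (N : R).

Lemma off_boxM N F G : off_box N G -> off_box N (fun x => F x * G x).
Proof. by move=> G0 x xN; rewrite G0// mulr0. Qed.

Lemma off_boxD N F G : off_box N F -> off_box N G -> off_box N (fun x => F x + G x).
Proof. by move=> F0 G0 x xN; rewrite F0// G0// addr0. Qed.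

(** The class of terms that may be added to a pointwise inequality without changing its integral.
    Continuity and bounded support make its members integrable, whence closure under sums and
    multiples. *)
Definition zero_mean N G := [/\ continuous G, off_box N G &
  (\int[lebesgue_tuple d]_(t in [set: d.-tuple T]) (G (row_of t))%:E = 0)%E].

Lemma zero_mean_grad N F dF j : has_grad F dF -> off_box N F -> zero_mean N (dF j).
Proof.
move=> hF F0; split; [by case: hF|exact: off_box_grad hF F0|].
exact: integral_grad_eq0 hF F0.
Qed.

Lemma zero_meanD N F G : zero_mean N F -> zero_mean N G ->
  zero_mean N (fun x => F x + G x).
Proof.
move=> [cF F0 iF] [cG G0 iG]; split; [exact: continuous_rowD|exact: off_boxD|].
under eq_integral do rewrite EFinD.
rewrite integralD//; first by rewrite iF iG adde0.
- exact: (off_box_integrable cF F0).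
- exact: (off_box_integrable cG G0).
Qed.

Lemma zero_meanZ N (a : R) G : zero_mean N G -> zero_mean N (fun x => a * G x).
Proof.
move=> [cG G0 iG]; split; [|exact: off_boxM|].
  by apply: continuous_rowM => //; exact: cst_continuous.
under eq_integral do rewrite EFinM.
by rewrite integralZl// ?iG ?mule0//; exact: (off_box_integrable cG G0).
Qed.

Lemma zero_mean_sum N (I : Type) (r : seq I) (G : I -> E -> R) :
  (forall i, zero_mean N (G i)) -> zero_mean N (fun x => \sum_(i <- r) G i x).
Proof.
move=> h; elim: r => [|i r IH].
  rewrite (_ : (fun x => _) = (fun=> 0)); last by apply/funext => x; rewrite big_nil.
  by split; [exact: cst_continuous|by []|rewrite integral0].
rewrite (_ : (fun x => _) = (fun x => G i x + \sum_(i <- r) G i x)).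
  exact: zero_meanD.
by apply/funext => x; rewrite big_cons.
Qed.

End zero_mean.

Section fields.
Local Open Scope classical_set_scope.
Context {R : realType} {d : nat}.
Local Notation E := 'rV[R]_d.
Implicit Types (F : E -> R) (dF : 'I_d -> E -> R) (x z : E).

Lemma has_gradV F dF : (forall x, F x != 0) -> has_grad F dF ->
  has_grad (fun x => (F x)^-1) (fun j x => - (F x)^-1 ^+ 2 * dF j x).
Proof.
move=> F0 hF; apply: (@has_grad_comp _ _ (fun y : R => y^-1) (fun y => - y^-1 ^+ 2) F dF) => // x.
  have did : derivable (id : R -> R) (F x) 1 by exact: derivable_id.
  split; first exact: (@derivableV R R id (F x) 1 (F0 x) did).
  have := @deriveV R R id (F x) 1 (F0 x) did.
  by rewrite derive_id /GRing.scale/= mulr1 exprVn.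
have c : {for F x, continuous (fun y : R => y^-1)} by exact: inv_continuous.
have -> : (fun y : R => - y^-1 ^+ 2) =
    - ((fun y : R => y^-1) * (fun y : R => y^-1) : R -> R).
  by apply/funext => y; rewrite expr2.
exact: (continuousN (continuousM c c)).
Qed.

Lemma has_grad_ln F dF : (forall x, 0 < F x) -> has_grad F dF ->
  has_grad (fun x => ln (F x)) (fun j x => (F x)^-1 * dF j x).
Proof.
move=> F0 hF; apply: (@has_grad_comp _ _ (@ln R) (fun y => y^-1) F dF) => // x.
  exact: is_derive1_ln.
by apply: inv_continuous; rewrite gt_eqF.
Qed.

Lemma has_grad_expR F dF : has_grad F dF ->
  has_grad (fun x => expR (F x)) (fun j x => expR (F x) * dF j x).
Proof.
move=> hF; apply: (@has_grad_comp _ _ (@expR R) (@expR R) F dF) => // x.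
exact: continuous_expR.
Qed.

(** * Squared distances, radial fields and their divergences *)

Definition dist2 z x : R := \sum_(i < d) (x 0 i - z 0 i) ^+ 2.

Lemma dist2_ge0 z x : 0 <= dist2 z x.
Proof. by apply: sumr_ge0 => i _; exact: sqr_ge0. Qed.

Lemma has_grad_shift z k : has_grad (fun x => x 0 k - z 0 k) (fun j _ => (j == k)%:R).
Proof.
apply: has_grad_ext (has_gradB (has_grad_coord k) (has_grad_cst (z 0 k))) => // j x.
by rewrite subr0.
Qed.

Lemma has_grad_dist2 z : has_grad (dist2 z) (fun j x => 2 * (x 0 j - z 0 j)).
Proof.
have h i := has_gradM (has_grad_shift z i) (has_grad_shift z i).
apply: has_grad_ext (has_grad_sum (index_enum 'I_d) h) => [x|j x].
  by apply: eq_bigr => i _; rewrite expr2.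
rewrite (bigD1 j)//= eqxx big1 => [|i /negbTE ij].
  by rewrite !mulr1 addr0 -mulr2n mulr_natl.
by rewrite eq_sym ij/= !mulr0 addr0.
Qed.

Lemma has_grad_radial z F dF k : has_grad F dF ->
  has_grad (fun x => (x 0 k - z 0 k) * F x)
    (fun j x => (x 0 k - z 0 k) * dF j x + F x * (j == k)%:R).
Proof. by move=> hF; exact: (has_gradM (has_grad_shift z k) hF). Qed.

Lemma dist2_le z x : dist2 0 x <= 2 * dist2 z x + 2 * dist2 0 z /\
  dist2 z x <= 2 * dist2 0 x + 2 * dist2 0 z.
Proof.
rewrite /dist2 !mulr_sumr -!big_split/=; split; apply: ler_sum => i _;
  rewrite !mxE; set u := x 0 i; set v := z 0 i.
  by have := sqr_ge0 (u - v - v); clear; nra.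
by have := sqr_ge0 (u + v); clear; nra.
Qed.

(** Each divergence below has summands of this form; after summation only [s], [t], the inner
    product of [x] and [x - z], and [d] are left, so [field] can conclude. *)
Lemma sum_quadratic (al be ga om : R) x z :
  \sum_(j < d) (al * x 0 j ^+ 2 + be * (x 0 j - z 0 j) ^+ 2 +
    ga * (x 0 j * (x 0 j - z 0 j)) + om) =
  al * dist2 0 x + be * dist2 z x + ga * (\sum_(j < d) x 0 j * (x 0 j - z 0 j)) + d%:R * om.
Proof.
rewrite !big_split/= sumr_const card_ord -!mulr_sumr mulr_natl /dist2.
by congr (_ * _ + _ + _ + _); apply: eq_bigr => i _; rewrite mxE subr0.
Qed.

Section vector_fields.
Variables (a delta eps kappa eta : R) (z : E).
Hypotheses (a0 : 0 <= a) (da : d%:R = 2 * (a + 1)) (delta0 : 0 < delta)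
  (eta0 : 0 < eta) (kappa0 : 0 <= kappa) (eps0 : 0 <= eps).
Local Notation s := (dist2 0).
Local Notation t := (dist2 z).

Definition hardy_factor x : R := a / (s x + eta).
(** The field [V], written with the null centre so that it is an instance of [has_grad_radial]. In
    the gradients the first index is the component and the second the direction of
    differentiation. *)
Definition hardy_field (j : 'I_d) x : R := (x 0 j - (0 : E) 0 j) * hardy_factor x.
Definition hardy_grad (j i : 'I_d) x : R :=
  (x 0 j - (0 : E) 0 j) * (- a / (s x + eta) ^+ 2 * (2 * x 0 i)) + hardy_factor x * (i == j)%:R.

Let seta x : 0 < s x + eta. Proof. exact: (ltr_wpDl (dist2_ge0 _ _)). Qed.
Let tdelta x : 0 < t x + delta. Proof. exact: (ltr_wpDl (dist2_ge0 _ _)). Qed.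
Let s1 x : 0 < 1 + s x. Proof. exact: (ltr_wpDr (dist2_ge0 _ _)). Qed.
Let t1 x : 0 < 1 + t x. Proof. exact: (ltr_wpDr (dist2_ge0 _ _)). Qed.

Lemma has_grad_hardy j : has_grad (hardy_field j) (hardy_grad j).
Proof.
apply: has_grad_radial.
have h : has_grad (fun x => s x + eta) (fun i x => 2 * (x 0 i - (0 : E) 0 i) + 0).
  exact: (has_gradD (has_grad_dist2 0) (has_grad_cst eta)).
have := has_gradZ a (has_gradV (fun x => lt0r_neq0 (seta x)) h).
apply: has_grad_ext => // i x; rewrite mxE subr0 addr0 exprVn; ring.
Qed.

(** Since [d = 2 (a + 1)], [div V - |V|^2] exceeds the left-hand side by exactly
    [2 a (a + 1) eta / (s + eta)^2]. *)
Lemma div_hardy x :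
  a ^+ 2 * s x / (s x + eta) ^+ 2 <=
  \sum_(j < d) (hardy_grad j j x - hardy_field j x ^+ 2).
Proof.
rewrite [leRHS](_ : _ = \sum_(j < d) ((- 2 * a / (s x + eta) ^+ 2 - hardy_factor x ^+ 2) * x 0 j ^+ 2
   + 0 * (x 0 j - z 0 j) ^+ 2 + 0 * (x 0 j * (x 0 j - z 0 j)) + hardy_factor x)); last first.
  apply: eq_bigr => j _; rewrite /hardy_grad /hardy_field eqxx mxE subr0 mulr1; ring.
rewrite sum_quadratic !mul0r !addr0 da /hardy_factor -subr_ge0.
have n0 : s x + eta != 0 by rewrite gt_eqF.
rewrite (_ : _ - _ = 2 * a * (a + 1) * eta / (s x + eta) ^+ 2); last by field.
by rewrite divr_ge0 ?sqr_ge0// !mulr_ge0// ?addr_ge0// ltW.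
Qed.

Definition log_factor x : R := log_weight a delta (s x) (t x) eta.
Definition log_factor_grad (i : 'I_d) x : R := log_factor x *
  (a * (2 * x 0 i) / (s x + eta) - (a + 1) * (2 * (x 0 i - z 0 i)) / (t x + delta)
   - 2 * (x 0 i - z 0 i) / ((1 + t x) * log_denom (t x))).

(** The field [W]: the origin part points outwards, the logarithmic part towards [z]. *)
Definition well_field (j : 'I_d) x : R := eps *
  (kappa * ((x 0 j - (0 : E) 0 j) * origin_weight (s x)) - (x 0 j - z 0 j) * log_factor x).
Definition well_grad (j i : 'I_d) x : R := eps *
  (kappa * ((x 0 j - (0 : E) 0 j) * (- 3 * (1 + s x) ^- 4 * (2 * x 0 i)) + origin_weight (s x) * (i == j)%:R)
   - ((x 0 j - z 0 j) * log_factor_grad i x + log_factor x * (i == j)%:R)).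

Let lt0 x : 0 < log_denom (t x).
Proof. exact: (lt_le_trans ltr01 (log_denom_ge1 (dist2_ge0 _ _))). Qed.

Lemma has_grad_log_factor : has_grad log_factor log_factor_grad.
Proof.
have hs := has_gradD (has_grad_dist2 0) (has_grad_cst eta).
have ht := has_gradD (has_grad_dist2 z) (has_grad_cst delta).
have h1 := has_gradD (has_grad_cst 1) (has_grad_dist2 z).
have hl := has_gradD (has_grad_cst 1) (has_grad_ln t1 h1).
have hiv := has_gradV (fun x => lt0r_neq0 (lt0 x)) hl.
have he := has_grad_expR (has_gradB (has_gradZ a (has_grad_ln seta hs))
  (has_gradZ (a + 1) (has_grad_ln tdelta ht))).
apply: has_grad_ext (has_gradM he hiv) => [//|i x].
rewrite /log_factor_grad /log_factor /log_weight mxE subr0 !addr0 !add0r.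
have ? : s x + eta != 0 by rewrite gt_eqF.
have ? : t x + delta != 0 by rewrite gt_eqF.
have ? : 1 + t x != 0 by rewrite gt_eqF.
have ? : log_denom (t x) != 0 by rewrite gt_eqF.
by field; apply/and4P.
Qed.

Lemma has_grad_well j : has_grad (well_field j) (well_grad j).
Proof.
have h1 : has_grad (fun x => 1 + s x) (fun i x => 0 + 2 * (x 0 i - (0 : E) 0 i)).
  exact: (has_gradD (has_grad_cst 1) (has_grad_dist2 0)).
have hv := has_gradV (fun x => lt0r_neq0 (s1 x)) h1.
have hw : has_grad (fun x => origin_weight (s x)) (fun i x => - 3 * (1 + s x) ^- 4 * (2 * x 0 i)).
  apply: has_grad_ext (has_gradM hv (has_gradM hv hv)) => [x|i x].
    by rewrite /origin_weight -exprVn; ring.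
  by rewrite mxE subr0 add0r -exprVn; ring.
exact: (has_gradZ eps (has_gradB (has_gradZ kappa (has_grad_radial 0 j hw))
  (has_grad_radial z j has_grad_log_factor))).
Qed.

(** The cross term of [|W|^2] is removed by adding the square of [kappa u w + y L], which doubles
    the diagonal terms. The products of [x] and [x - z] then have coefficient [ga = 0], by the
    choice of [log_weight], and the remaining excess is proportional to [eta] and nonnegative. *)
Lemma div_well x :
  eps * (log_potential a delta (s x) (t x) eta + kappa * origin_potential (s x)) -
    2 * eps ^+ 2 * (log_factor x ^+ 2 * t x + kappa ^+ 2 * (origin_weight (s x) ^+ 2 * s x)) <=
  \sum_(j < d) (well_grad j j x - 2 * hardy_field j x * well_field j x - well_field j x ^+ 2).
Proof.
set L := log_factor x; set w := origin_weight (s x); set v := (1 + s x)^-1.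
set l := log_denom (t x); set h := hardy_factor x.
pose ga := eps * L * (2 * h - a * 2 / (s x + eta)).
pose al := eps * kappa * (- 6 * v ^+ 4 - 2 * h * w) - 2 * eps ^+ 2 * kappa ^+ 2 * w ^+ 2.
pose be := eps * L * (2 * (a + 1) / (t x + delta) + 2 / ((1 + t x) * l)) - 2 * eps ^+ 2 * L ^+ 2.
apply: (@le_trans _ _ (\sum_(j < d) (al * x 0 j ^+ 2 + be * (x 0 j - z 0 j) ^+ 2 +
    ga * (x 0 j * (x 0 j - z 0 j)) + eps * (kappa * w - L)))); last first.
  apply: ler_sum => j _.
  rewrite /well_grad /well_field /hardy_field /log_factor_grad eqxx mxE subr0 !mulr1.
  rewrite -/L -/w -/h -/l -exprVn -/v /al /be /ga -subr_ge0.
  set u := x 0 j; set y := u - z 0 j.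
  rewrite (_ : _ - _ = eps ^+ 2 * (kappa * u * w + y * L) ^+ 2); last by ring.
  by rewrite mulr_ge0 ?sqr_ge0.
rewrite sum_quadratic da -subr_ge0.
have n1 : s x + eta != 0 by rewrite gt_eqF.
have n2 : t x + delta != 0 by rewrite gt_eqF.
have n3 : 1 + t x != 0 by rewrite gt_eqF.
have n4 : l != 0 by rewrite gt_eqF// /l lt0.
have n5 : 1 + s x != 0 by rewrite gt_eqF.
have -> : ga = 0 by rewrite /ga /h /hardy_factor; ring.
have -> : log_potential a delta (s x) (t x) eta =
    L * (2 * t x / ((1 + t x) * l) - 2 * (a + 1) * delta / (t x + delta)) by [].
have -> : origin_potential (s x) = 2 * w - 6 * v ^+ 4 * s x.
  by rewrite /origin_potential /w /origin_weight /v; field.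
rewrite (_ : _ - _ = 2 * eps * kappa * w * a * eta / (s x + eta)).
  rewrite divr_ge0 ?(ltW (seta x))// !mulr_ge0// ?(ltW eta0)//.
  by rewrite /w /origin_weight invr_ge0 exprn_ge0// ltW.
rewrite /al /be /h /hardy_factor; field.
by rewrite n1 n2 n3 n4.
Qed.

End vector_fields.
End fields.

(** * The pointwise inequality *)

Section scalar_bounds.
Context {R : realType}.

Lemma young_sqr (k m M x y : R) : 0 < k -> m ^+ 2 <= M ->
  m * (x * y) <= k / 2 * x ^+ 2 + M / (2 * k) * y ^+ 2.
Proof.
move=> k0 mM.
apply: (@le_trans _ _ (k / 2 * x ^+ 2 + m ^+ 2 / (2 * k) * y ^+ 2)).
  rewrite -subr_ge0 (_ : _ - _ = (k * x - m * y) ^+ 2 / (2 * k)).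
    by rewrite divr_ge0 ?sqr_ge0// mulr_ge0// ltW.
  by field; rewrite gt_eqF.
by rewrite lerD2l ler_wpM2r ?sqr_ge0// ler_wpM2r ?invr_ge0 ?mulr_ge0 ?(ltW k0).
Qed.

(** Young's inequality puts the small weight [k] on [|psi|^2] and the large one [M / k] on the
    energy density [PP]. *)
Lemma current_bound (f g pj qj pk qk mj mk M k chi PP : R) :
  0 < k -> 0 <= chi -> mj ^+ 2 <= M -> mk ^+ 2 <= M -> 0 <= M ->
  pj ^+ 2 + qj ^+ 2 <= PP -> pk ^+ 2 + qk ^+ 2 <= PP ->
  2 * chi * (pj * qk - qj * pk) + mj * (f * qk - g * pk) - mk * (f * qj - g * pj)
  <= (2 * chi + M / k) * PP + k * (f ^+ 2 + g ^+ 2).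
Proof.
move=> k0 chi0 mjM mkM M0 Pj Pk.
have h1 := young_sqr f qk k0 mjM.
have mjM' : (- mj) ^+ 2 <= M by rewrite sqrrN.
have mkM' : (- mk) ^+ 2 <= M by rewrite sqrrN.
have h2 := young_sqr g pk k0 mjM'.
have h3 := young_sqr f qj k0 mkM'.
have h4 := young_sqr g pj k0 mkM.
have Mk0 : 0 <= M / (2 * k) by rewrite divr_ge0// mulr_ge0// ltW.
have h5 := ler_wpM2l Mk0 Pj; have h6 := ler_wpM2l Mk0 Pk.
have h7 : chi * (2 * (pj * qk - qj * pk)) <= chi * (PP + PP).
  rewrite ler_wpM2l//; apply: le_trans (lerD Pj Pk).
  have := sqr_ge0 (pj - qk); have := sqr_ge0 (qj + pk).
  by clear; nra.
have e : M / k * PP = M / (2 * k) * PP + M / (2 * k) * PP.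
  by field; rewrite gt_eqF.
rewrite [(_ + M / k) * PP]mulrDl e; clear -h1 h2 h3 h4 h5 h6 h7.
set u := M / (2 * k) in h1 h2 h3 h4 h5 h6 *; clearbody u; lra.
Qed.

(** The bound [ln y <= y], applied to [sqrt s] and to its inverse, gives
    [ln (sqrt s) ^+ 2 <= s1 + 1 / s0]. *)
Lemma rho_lower (s0 s1 s : R) : 0 < s0 -> s0 <= s -> s <= s1 ->
  (1 + s1 * (s1 + s0^-1))^-1 <= rho s.
Proof.
move=> s00 s0s ss1.
have sp : 0 < s by exact: lt_le_trans s0s.
have q0 : 0 < Num.sqrt s by rewrite sqrtr_gt0.
have qV0 : 0 < (Num.sqrt s)^-1 by rewrite invr_gt0.
have s1p : 0 < s1 by exact: lt_le_trans ss1.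
have h1 : ln (Num.sqrt s) <= Num.sqrt s by rewrite ltW// ln_sublinear.
have h2 : - ln (Num.sqrt s) <= (Num.sqrt s)^-1.
  by rewrite -lnV ?posrE// ltW// ln_sublinear.
have h3 : ln (Num.sqrt s) ^+ 2 <= s1 + s0^-1.
  have [l0|l0] := leP 0 (ln (Num.sqrt s)).
    apply: (@le_trans _ _ (Num.sqrt s ^+ 2)); first by rewrite ler_pXn2r ?nnegrE// ltW.
    by rewrite sqr_sqrtr ?(ltW sp)// (le_trans ss1)// lerDl invr_ge0 ltW.
  rewrite -sqrrN; apply: (@le_trans _ _ ((Num.sqrt s)^-1 ^+ 2)).
    by rewrite ler_pXn2r ?nnegrE ?oppr_ge0// ltW.
  rewrite exprVn sqr_sqrtr ?(ltW sp)//; apply: (@le_trans _ _ s0^-1).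
    by rewrite lef_pV2 ?posrE.
  by rewrite lerDr ltW.
have h4 : s * ln (Num.sqrt s) ^+ 2 <= s1 * (s1 + s0^-1).
  by apply: ler_pM; rewrite ?sqr_ge0 ?(ltW sp).
rewrite /rho div1r lef_pV2 ?posrE; first by rewrite lerD2l.
  by rewrite ltr_wpDr// mulr_ge0 ?addr_ge0 ?invr_ge0 ?ltW.
by rewrite ltr_wpDr// mulr_ge0 ?sqr_ge0 ?ltW.
Qed.

End scalar_bounds.

Section pointwise.
Local Open Scope classical_set_scope.
Context {R : realType} {d : nat}.
Local Notation E := 'rV[R]_d.
Local Notation s := (dist2 (0 : E)).

Section currents.
Variables (f g : E -> R) (df dg : 'I_d -> E -> R) (ddf ddg : 'I_d -> 'I_d -> E -> R).
Variables (A : 'I_d -> E -> R) (dA : 'I_d -> 'I_d -> E -> R).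
Hypotheses (hf : has_grad f df) (hg : has_grad g dg).
Hypotheses (hdf : forall k, has_grad (df k) (ddf k)) (hdg : forall k, has_grad (dg k) (ddg k)).
Hypothesis hA : forall k, has_grad (A k) (dA k).

(* [cov_re k + i cov_im k] is the [k]-th component of [(grad - i A) (f + i g)]. *)
Definition cov_re k x : R := df k x + A k x * g x.
Definition cov_im k x : R := dg k x - A k x * f x.
Definition density x : R := f x ^+ 2 + g x ^+ 2.
Definition density_grad (j : 'I_d) x : R := 2 * (f x * df j x + g x * dg j x).
(** The probability current: the imaginary part of the conjugate of [psi] times [P_k psi], where
    [psi = f + i g]. *)
Definition current k x : R := f x * cov_im k x - g x * cov_re k x.
Definition current_grad (k j : 'I_d) x : R :=
  (f x * (ddg k j x - (A k x * df j x + f x * dA k j x)) + cov_im k x * df j x) -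
  (g x * (ddf k j x + (A k x * dg j x + g x * dA k j x)) + cov_re k x * dg j x).

Lemma has_grad_density : has_grad density density_grad.
Proof.
apply: has_grad_ext (has_gradD (has_gradM hf hf) (has_gradM hg hg)) => [x|j x].
  by rewrite /density !expr2.
by rewrite /density_grad; ring.
Qed.

Lemma has_grad_current k : has_grad (current k) (current_grad k).
Proof.
exact: (has_gradB (has_gradM hf (has_gradB (hdg k) (has_gradM (hA k) hf)))
  (has_gradM hg (has_gradD (hdf k) (has_gradM (hA k) hg)))).
Qed.

Lemma continuous_energy : continuous (fun x => \sum_(j < d) (cov_re j x ^+ 2 + cov_im j x ^+ 2)).
Proof.
have h j := has_gradD (hdf j) (has_gradM (hA j) hg).
have h' j := has_gradB (hdg j) (has_gradM (hA j) hf).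
have H j := has_gradD (has_gradM (h j) (h j)) (has_gradM (h' j) (h' j)).
have [+ _ _] := has_grad_sum (index_enum 'I_d) H.
rewrite (_ : (fun x => _) = (fun x => \sum_(j < d) (cov_re j x ^+ 2 + cov_im j x ^+ 2)))//.
Qed.

(* The curl of the current recovers the magnetic field times the density, the
   other terms being quadratic in [(grad - i A + V) psi]. *)
Lemma current_curl (j k : 'I_d) x (chi chij chik Vj Vk : R) :
  let pj := cov_re j x + Vj * f x in let qj := cov_im j x + Vj * g x in
  let pk := cov_re k x + Vk * f x in let qk := cov_im k x + Vk * g x in
  chi * (dA k j x - dA j k x) * density x =
  - ((chi * current_grad k j x + current k x * chij) -
     (chi * current_grad j k x + current j x * chik))
  + (2 * chi * (pj * qk - qj * pk) + (chij - 2 * chi * Vj) * (f x * qk - g x * pk)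
     - (chik - 2 * chi * Vk) * (f x * qj - g x * pj)).
Proof.
(* Second derivatives of [f] and [g] enter antisymmetrised in [j] and [k], so they cancel and a
   polynomial identity remains. *)
rewrite /current_grad (has_grad_mixed x hf (hdf j) (hdf k)) (has_grad_mixed x hg (hdg j) (hdg k)).
rewrite /density /current /cov_re /cov_im; ring.
Qed.

(** In the expansion of [|(P + V) psi|^2] the cross term is [V . grad |psi|^2]: the potential [A]
    drops out of it because it is real. *)
Lemma hardy_square (V dV : 'I_d -> R) x :
  \sum_(j < d) (cov_re j x ^+ 2 + cov_im j x ^+ 2) +
  \sum_(j < d) (V j * density_grad j x + density x * dV j) =
  \sum_(j < d) ((cov_re j x + V j * f x) ^+ 2 + (cov_im j x + V j * g x) ^+ 2) +
  (\sum_(j < d) (dV j - V j ^+ 2)) * density x.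
Proof.
rewrite mulr_suml -!big_split/=; apply: eq_bigr => j _.
rewrite /cov_re /cov_im /density /density_grad; ring.
Qed.

(** The two sides differ by [|(P + V + W) psi|^2]. *)
Lemma well_square (V W dW : 'I_d -> R) x :
  (\sum_(j < d) (dW j - 2 * V j * W j - W j ^+ 2)) * density x <=
  \sum_(j < d) ((cov_re j x + V j * f x) ^+ 2 + (cov_im j x + V j * g x) ^+ 2) +
  \sum_(j < d) (W j * density_grad j x + density x * dW j).
Proof.
rewrite mulr_suml -!big_split/=; apply: ler_sum => j _; rewrite -subr_ge0.
rewrite (_ : _ - _ = (cov_re j x + V j * f x + W j * f x) ^+ 2 +
  (cov_im j x + V j * g x + W j * g x) ^+ 2); first by rewrite addr_ge0 ?sqr_ge0.
rewrite /cov_re /cov_im /density /density_grad; ring.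
Qed.

End currents.

Definition cutoff tau (z : E) x : R := pospart (tau - dist2 z x) ^+ 2.
Definition cutoff_grad tau (z : E) (j : 'I_d) x : R :=
  2 * pospart (tau - dist2 z x) * - (2 * (x 0 j - z 0 j)).

Lemma has_grad_cutoff tau z : has_grad (cutoff tau z) (cutoff_grad tau z).
Proof.
have h := has_gradB (has_grad_cst tau) (has_grad_dist2 z).
have := @has_grad_comp _ _ (fun y : R => pospart y ^+ 2) (fun y => 2 * pospart y) _ _ _ _ h.
have H1 x : is_derive (tau - dist2 z x) 1 (fun y => pospart y ^+ 2) (2 * pospart (tau - dist2 z x)).
  exact: is_derive_pospart_sqr.
have H2 (x : E) : {for tau - dist2 z x, continuous (fun y : R => 2 * pospart y)}.
  rewrite /prop_for/=; apply: (@continuousM _ _ (fun=> 2) pospart).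
    exact: cst_continuous.
  exact: continuous_pospart.
move=> /(_ H1 H2); apply: has_grad_ext => // j x.
by rewrite /cutoff_grad sub0r.
Qed.

Lemma coord_le_dist2 (z x : E) j : `|x 0 j - z 0 j| <= 1 + dist2 z x.
Proof.
have : (x 0 j - z 0 j) ^+ 2 <= dist2 z x.
  by rewrite /dist2 (bigD1 j)//= lerDl sumr_ge0// => i _; exact: sqr_ge0.
have := sqr_ge0 (`|x 0 j - z 0 j| - 1).
rewrite -[(x 0 j - z 0 j) ^+ 2]real_normK ?num_real//.
have := normr_ge0 (x 0 j - z 0 j).
move: `|_| (dist2 z x) => u v; clear; nra.
Qed.

(** These are the coefficients of the mixed terms in [current_curl]. Staying at [s >= s0] bounds [V]
    by [a (1 + 1 / s0)], uniformly in [eta]. *)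
Lemma cutoff_coef_bound (a tau s0 eta : R) (z x : E) j : 0 <= a -> 0 < s0 -> 0 < eta ->
  dist2 z x < tau -> s0 <= s x ->
  (cutoff_grad tau z j x - 2 * cutoff tau z x * hardy_field a eta j x) ^+ 2 <=
  (4 * tau * (1 + tau) + 2 * tau ^+ 2 * (a * (1 + s0^-1))) ^+ 2.
Proof.
move=> a0 s00 eta0 tt ss.
have t0 := dist2_ge0 z x.
have tau0 : 0 <= tau by rewrite (le_trans t0)// ltW.
have sp : 0 < s x by exact: lt_le_trans ss.
rewrite /cutoff_grad /cutoff /hardy_field /hardy_factor pospart_id ?subr_ge0 ?(ltW tt)//.
have hV : `|(x 0 j - (0 : E) 0 j) * (a / (s x + eta))| <= a * (1 + s0^-1).
  rewrite normrM (ger0_norm (x := a / _)); last by rewrite divr_ge0// addr_ge0// ltW.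
  rewrite mulrCA; apply: ler_wpM2l => //.
  apply: (@le_trans _ _ ((1 + s x) / s x)).
    apply: ler_pM => //; first by rewrite invr_ge0 addr_ge0// ltW.
      exact: coord_le_dist2.
    by rewrite lef_pV2 ?posrE ?addr_gt0// lerDl ltW.
  rewrite mulrDl mul1r divff ?gt_eqF// addrC lerD2l lef_pV2 ?posrE//.
rewrite -[leLHS]real_normK ?num_real// ler_pXn2r ?nnegrE//; last first.
  by rewrite addr_ge0// !mulr_ge0 ?addr_ge0 ?invr_ge0 ?sqr_ge0// ltW.
apply: le_trans (ler_normB _ _) _; apply: lerD.
  rewrite !normrM normrN !normrM !normr_nat (ger0_norm (x := tau - _)) ?subr_ge0 ?(ltW tt)//.
  have -> : 2 * (tau - dist2 z x) * (2 * `|x 0 j - z 0 j|) =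
    4 * (tau - dist2 z x) * `|x 0 j - z 0 j| by ring.
  rewrite ler_pM ?mulr_ge0 ?subr_ge0 ?(ltW tt)//.
    by rewrite ler_wpM2l// gerBl.
  by apply: le_trans (coord_le_dist2 _ _ _) _; rewrite lerD2l ltW.
rewrite normrM normrM normr_nat (ger0_norm (x := _ ^+ 2)) ?sqr_ge0//.
apply: ler_pM => //; first by rewrite mulr_ge0 ?sqr_ge0.
by rewrite ler_wpM2l// ler_pXn2r ?nnegrE ?subr_ge0 ?(ltW tt)// gerBl.
Qed.

(** The order of quantifiers matters: [c] precedes the wave function, the potential [A], the support
    size [N] and [eta]. *)
Lemma magnetic_hardy_pointwise (a b0 s0 tau2 : R) (z : E) (j0 k0 : 'I_d) :
  0 <= a -> d%:R = 2 * (a + 1) -> 0 < b0 -> 0 < s0 -> 0 < tau2 ->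
  exists2 c : R, 0 < c & forall f g df dg ddf ddg A dA N eta,
    has_grad f df -> has_grad g dg ->
    (forall k, has_grad (df k) (ddf k)) -> (forall k, has_grad (dg k) (ddg k)) ->
    (forall k, has_grad (A k) (dA k)) ->
    off_box N f -> off_box N g ->
    (forall x, dist2 z x < tau2 -> b0 <= dA k0 j0 x - dA j0 k0 x /\ s0 <= s x) ->
    0 < eta <= 1 ->
    exists2 G, zero_mean N G & forall x,
      (a ^+ 2 * s x / (s x + eta) ^+ 2 + c * rho (s x)) * density f g x <=
      \sum_(j < d) (cov_re g df A j x ^+ 2 + cov_im f dg A j x ^+ 2) + G x.
Proof.
move=> a0 da b00 s00 tau20.
(* The loss [C] is confined to [t < tau], while the cutoff lives on [t < tau2]; where the loss
   occurs, the cutoff is thus at least [chi0]. *)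
pose tau := tau2 / 2; have tau0 : 0 < tau by rewrite divr_gt0.
have m0 := dist2_ge0 (0 : E) z.
have [delta [kappa [eps [c [C [[delta0 kappa0 eps0 c0 C0] H]]]]]] := weight_inequality a0 m0 tau0.
pose s1 := 2 * tau2 + 2 * dist2 0 z.
have s10 : 0 <= s1 by rewrite addr_ge0// mulr_ge0// ltW.
pose rD := (1 + s1 * (s1 + s0^-1))^-1.
have rD0 : 0 < rD.
  by rewrite invr_gt0 ltr_wpDr// mulr_ge0// addr_ge0// invr_ge0 ltW.
pose chi0 := (tau2 / 2) ^+ 2.
have chi00 : 0 < chi0 by rewrite exprn_gt0// divr_gt0.
(* [th] copies of the magnetic term outweigh [C]; [k'] is then tuned so that the density error
   [th * k'] takes only half of the gain [c * rho], as [rD <= rho] on the support of the cutoff. *)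
pose th := (C + 1) / (chi0 * b0).
have th0 : 0 < th by rewrite divr_gt0 ?mulr_gt0// ltr_wpDl.
have thE : th * (chi0 * b0) = C + 1 by rewrite divfK// gt_eqF// mulr_gt0.
pose k' := c * rD / (2 * th).
have k'0 : 0 < k' by apply: divr_gt0; exact: mulr_gt0.
have k'E : th * k' = c * rD / 2 by rewrite /k'; field; rewrite gt_eqF.
pose M := (4 * tau2 * (1 + tau2) + 2 * tau2 ^+ 2 * (a * (1 + s0^-1))) ^+ 2.
have M0 : 0 <= M by exact: sqr_ge0.
pose C5 := 2 * tau2 ^+ 2 + M / k'.
have C50 : 0 <= C5.
  by apply: addr_ge0; [rewrite mulr_ge0// sqr_ge0|rewrite divr_ge0// ltW].
have D0 : 0 < 1 + th * C5 by rewrite ltr_wpDr// mulr_ge0// ltW.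
(* The argument spends [1 + th * C5] copies of [|(P + V) psi|^2], and only one is available. *)
pose io := (1 + th * C5)^-1; have io0 : 0 < io by rewrite invr_gt0.
exists (io * (c / 2)); first by apply: mulr_gt0 => //; exact: divr_gt0.
move=> f g df dg ddf ddg A dA N eta hf hg hdf hdg hA f0 g0 HD eta01.
have eta0 : 0 < eta by case/andP: eta01.
pose V := @hardy_field R d a eta; pose dV := @hardy_grad R d a eta.
pose W := well_field a delta eps kappa eta z; pose dW := well_grad a delta eps kappa eta z.
have hV j : has_grad (V j) (dV j) by exact: has_grad_hardy.
have hW j : has_grad (W j) (dW j) by exact: has_grad_well.
pose chi := cutoff tau2 z; pose dchi := cutoff_grad tau2 z.
have hchi : has_grad chi dchi by exact: has_grad_cutoff.
have hn := has_grad_density hf hg.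
pose J := current f g df dg A; pose dJ := current_grad f g df dg ddf ddg A dA.
have hJ k : has_grad (J k) (dJ k) by exact: has_grad_current.
have n0 : off_box N (density f g).
  by move=> x xN; rewrite /density f0// g0// expr0n addr0.
have J0 k : off_box N (J k).
  by move=> x xN; rewrite /J /current f0// g0// !mul0r subr0.
pose cc k := fun (i : 'I_d) (x : E) => chi x * dJ k i x + J k x * dchi i x.
pose GV x := \sum_(j < d) (V j x * density_grad f g df dg j x + density f g x * dV j j x).
pose GW x := \sum_(j < d) (W j x * density_grad f g df dg j x + density f g x * dW j j x).
exists (fun x => GV x + (io * GW x + - (io * th) * (cc k0 j0 x + -1 * cc j0 k0 x))).
  have zV j : zero_mean N (fun x => V j x * density_grad f g df dg j x + density f g x * dV j j x).
    have h := zero_mean_grad j (has_gradM (hV j) hn).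
    by apply: h; exact: off_boxM n0.
  have zW j : zero_mean N (fun x => W j x * density_grad f g df dg j x + density f g x * dW j j x).
    have h := zero_mean_grad j (has_gradM (hW j) hn).
    by apply: h; exact: off_boxM n0.
  have zJ k i : zero_mean N (cc k i).
    have h := zero_mean_grad i (has_gradM hchi (hJ k)).
    by apply: h; exact: off_boxM (J0 k).
  apply: zero_meanD; last apply: zero_meanD.
  - exact: (zero_mean_sum _ zV).
  - by apply: zero_meanZ; exact: (zero_mean_sum _ zW).
  - apply: zero_meanZ; apply: zero_meanD; last apply: zero_meanZ; exact: zJ.
move=> x; set n := density f g x; set SD := \sum_(j < d) _.
pose p j := cov_re g df A j x + V j x * f x; pose q j := cov_im f dg A j x + V j x * g x.
pose PP := \sum_(j < d) (p j ^+ 2 + q j ^+ 2).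
have nge0 : 0 <= n by rewrite addr_ge0 ?sqr_ge0.
have I0 : a ^+ 2 * s x / (s x + eta) ^+ 2 * n + PP <= SD + GV x.
  rewrite /SD /GV (hardy_square _ _ _ _ _ (fun j => V j x) (fun j => dV j j x)).
  by rewrite addrC lerD2l ler_wpM2r// div_hardy.
set SW := \sum_(j < d) (dW j j x - 2 * V j x * W j x - W j x ^+ 2).
have I1 : SW * n <= PP + GW x.
  exact: (well_square f g df dg A (fun j => V j x) (fun j => W j x) (fun j => dW j j x) x).
have [sxt tsx] := dist2_le z x.
have tx0 := dist2_ge0 z x; have sx0 := dist2_ge0 0 x.
have I1' : c * rho (s x) - (if tau <= dist2 z x then 0 else C) <= SW.
  apply: le_trans (H _ _ eta eta01 sx0 tx0 sxt tsx) _.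
  exact: div_well.
pose S := cc k0 j0 x + -1 * cc j0 k0 x.
have rh0 : 0 <= rho (s x) by exact: rho_ge0.
have PPge j : p j ^+ 2 + q j ^+ 2 <= PP.
  by rewrite /PP (bigD1 j)//= lerDl sumr_ge0// => i _; rewrite addr_ge0 ?sqr_ge0.
have PP0 : 0 <= PP by apply: sumr_ge0 => i _; rewrite addr_ge0 ?sqr_ge0.
(* The commutator estimate compensates the well [C] of the field [W]. *)
have key : c / 2 * rho (s x) * n <= SW * n + th * (C5 * PP - S).
  have curl := @current_curl f g df dg ddf ddg A dA hf hg hdf hdg j0 k0 x
    (chi x) (dchi j0 x) (dchi k0 x) (V j0 x) (V k0 x).
  have SE : S = (chi x * dJ k0 j0 x + J k0 x * dchi j0 x) -
     (chi x * dJ j0 k0 x + J j0 x * dchi k0 x) by rewrite /S /cc mulN1r.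
  have cr := ler_wpM2r nge0 I1'.
  (* Off the support of the cutoff both it and its gradient vanish, and there is no loss to
     compensate. *)
  have [tt|tt] := leP tau2 (dist2 z x).
    have pp0 : pospart (tau2 - dist2 z x) = 0 by rewrite pospart_eq0// subr_le0.
    have chi_0 : chi x = 0 by rewrite /chi /cutoff pp0 expr0n.
    have dchi_0 j : dchi j x = 0 by rewrite /dchi /cutoff_grad pp0 mulr0 mul0r.
    have S0 : S = 0 by rewrite SE chi_0 !dchi_0 !mul0r !mulr0 !addr0 subr0.
    rewrite S0 subr0.
    have taut : tau <= dist2 z x.
      by apply: le_trans tt; rewrite /tau ler_pdivrMr// ler_peMr ?ler1n// ltW.
    move: cr; rewrite taut subr0 => cr.
    have h1 : 0 <= th * (C5 * PP) by apply: mulr_ge0; [exact: ltW|exact: mulr_ge0].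
    have h2 : 0 <= c * rho (s x) * n by rewrite mulr_ge0// mulr_ge0// ltW.
    clear -cr h1 h2; lra.
  have [bD sD] := HD x tt.
  have chi_ge0 : 0 <= chi x by exact: sqr_ge0.
  have chi_le : chi x <= tau2 ^+ 2.
    rewrite /chi /cutoff ler_pXn2r ?nnegrE ?pospart_ge0 ?(ltW tau20)//.
    by rewrite pospart_id ?subr_ge0 ?(ltW tt)// gerBl.
  have mM j : (dchi j x - 2 * chi x * V j x) ^+ 2 <= M by exact: cutoff_coef_bound.
  have cb := current_bound (f x) (g x) k'0 chi_ge0 (mM j0) (mM k0) M0 (PPge j0) (PPge k0).
  have rl : rD <= rho (s x).
    apply: rho_lower => //; apply: le_trans sxt _.
    by rewrite /s1 lerD2r ler_wpM2l// ltW.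
  have h1 : chi x * b0 * n <= - S + (C5 * PP + k' * n).
    apply: (@le_trans _ _ (chi x * (dA k0 j0 x - dA j0 k0 x) * n)).
      by rewrite ler_wpM2r// ler_wpM2l.
    rewrite /n curl SE lerD2l; apply: le_trans cb _; rewrite lerD2r ler_wpM2r//.
    by rewrite /C5 lerD2r ler_wpM2l.
  have h2 := ler_wpM2l (ltW th0) h1.
  have h3 : th * (k' * n) <= c / 2 * rho (s x) * n.
    rewrite mulrA k'E ler_wpM2r// mulrAC ler_wpM2l ?divr_ge0 ?(ltW c0)//.
  have h4 : (if tau <= dist2 z x then 0 else C) * n <= th * (chi x * b0 * n).
    case: ifPn => [_|].
      by rewrite mul0r; apply: mulr_ge0; [exact: ltW|rewrite mulr_ge0// mulr_ge0// ltW].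
    rewrite -ltNge => tn; rewrite mulrA ler_wpM2r//.
    apply: (@le_trans _ _ (th * (chi0 * b0))); first by rewrite thE lerDl.
    rewrite ler_pM2l// ler_pM2r// /chi0 /chi /cutoff.
    rewrite ler_pXn2r ?nnegrE ?pospart_ge0 ?divr_ge0 ?(ltW tau20)//.
    rewrite pospart_id ?subr_ge0 ?(ltW tt)//.
    by move: tn; rewrite /tau; clear; lra.
  clear -cr h2 h3 h4.
  move: (if _ then _ else _) cr h4 => K cr h4.
  rewrite mulrBl in cr; lra.
have I3 := ler_wpM2l (ltW io0) I1; have I4 := ler_wpM2l (ltW io0) key.
have ioE : io * (1 + th * C5) = 1 by rewrite mulVf// gt_eqF.
have ioP : io * PP + io * th * C5 * PP = PP.
  by rewrite -[RHS]mul1r -ioE; ring.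
rewrite -/S; clear -I0 I3 I4 ioP; lra.
Qed.

End pointwise.

(** * Passing to the limit *)

Section integration.
Local Open Scope classical_set_scope.
Context {R : realType}.

Lemma integral_le_sup_cvg (disp : measure_display) (T : measurableType disp)
    (mu : {measure set T -> \bar R}) (h : nat -> T -> R) (g : T -> R) (X : \bar R) :
  (forall n, measurable_fun [set: T] (h n)) -> (forall n t, 0 <= h n t) ->
  (forall t, {homo h ^~ t : m n / (m <= n)%N >-> m <= n}) ->
  (forall t, h ^~ t @ \oo --> g t) ->
  (forall n, (\int[mu]_t (h n t)%:E <= X)%E) -> (\int[mu]_t (g t)%:E <= X)%E.
Proof.
move=> mh h0 nd cv hX.
have mh' n : measurable_fun [set: T] (fun t => (h n t)%:E) by exact/measurable_EFinP.
have h0' n t : [set: T] t -> (0 <= (h n t)%:E)%E by rewrite lee_fin.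
have nd' t : [set: T] t -> {homo (fun n => (h n t)%:E) : m n / (m <= n)%N >-> (m <= n)%E}.
  by move=> _ m n mn; rewrite lee_fin nd.
have e : (\int[mu]_t (g t)%:E = \int[mu]_t limn (fun n => (h n t)%:E))%E.
  apply: eq_integral => t _; apply/esym/cvg_lim => //.
  by apply: cvg_EFin; [exact: nearW|exact: cv].
rewrite e (monotone_convergence mu measurableT mh' h0' nd').
apply: lime_le; last exact: nearW.
apply: ereal_nondecreasing_is_cvgn => m n mn.
by apply: ge0_le_integral => // t _; rewrite lee_fin//; exact: nd.
Qed.

Lemma measurable_fun_posV (disp : measure_display) (T : measurableType disp) (f : T -> R) :
  measurable_fun [set: T] f -> (forall t, 0 < f t) ->
  measurable_fun [set: T] (fun t => (f t)^-1).
Proof.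
move=> mf f0; rewrite (_ : (fun t => _) = (fun t => expR (- ln (f t)))).
  apply: measurableT_comp; first exact: measurable_expR.
  apply: measurableT_comp; first exact: oppr_measurable.
  by apply: measurableT_comp => //; exact: measurable_ln.
by apply/funext => t; rewrite expRN lnK// posrE.
Qed.

Lemma measurable_rho (disp : measure_display) (T : measurableType disp) (f : T -> R) :
  measurable_fun [set: T] f -> (forall t, 0 <= f t) ->
  measurable_fun [set: T] (fun t => rho (f t)).
Proof.
move=> mf f0; rewrite /rho; under eq_fun do rewrite div1r.
apply: measurable_fun_posV => [|t]; last first.
  by rewrite ltr_wpDr// mulr_ge0// sqr_ge0.
apply: measurable_funD => //; apply: measurable_funM => //.
apply: measurable_funX; apply: measurableT_comp; first exact: measurable_ln.
apply: measurableT_comp => //; apply: continuous_measurable_fun.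
exact: sqrt_continuous.
Qed.

(** At [s = 0] the sequence is null and the limit is [0^-1 = 0], so the convergence holds at every
    point. *)
Lemma hardy_quotient_cvg (s : R) : 0 <= s ->
  (fun n : nat => s / (s + n.+1%:R^-1) ^+ 2) @ \oo --> s^-1.
Proof.
rewrite le_eqVlt => /predU1P[<-|s0].
  by rewrite invr0; under eq_fun do rewrite mul0r; exact: cvg_cst.
have -> : s^-1 = s * ((s + 0)^-1 * (s + 0)^-1).
  by rewrite addr0 mulVKf// gt_eqF.
rewrite (_ : (fun n => _) = (fun n : nat => s * ((s + n.+1%:R^-1)^-1 * (s + n.+1%:R^-1)^-1))).
  have c : (fun n : nat => (s + n.+1%:R^-1)^-1 : R) @ \oo --> (s + 0)^-1.
    apply: cvgV; first by rewrite addr0 gt_eqF.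
    by apply: cvgD; [exact: cvg_cst|exact: cvg_harmonic].
  by apply: cvgM; [exact: cvg_cst|exact: cvgM].
by apply/funext => n; rewrite -invfM expr2.
Qed.

Lemma hardy_quotient_homo (s : R) : 0 <= s ->
  {homo (fun n : nat => s / (s + n.+1%:R^-1) ^+ 2) : m n / (m <= n)%N >-> m <= n}.
Proof.
move=> s0 m n mn; apply: ler_wpM2l => //.
have pos k : 0 < s + k.+1%:R^-1 by rewrite ltr_wpDl// invr_gt0.
rewrite lef_pV2 ?posrE ?exprn_gt0// ler_pXn2r ?nnegrE ?(ltW (pos _))//.
by rewrite lerD2l lef_pV2 ?posrE// ler_nat.
Qed.

Context {d : nat}.
Local Notation E := 'rV[R]_d.
Local Notation T := (measurableTypeR R).
Local Notation s := (dist2 (0 : E)).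

(** Integration at [eta = 1 / (k + 1)] removes [G]; the left-hand sides increase with [k], and
    monotone convergence yields both weights at once. *)
Lemma integral_hardy_weight (a c N : R) (n e : E -> R) :
  0 <= c -> (forall x, 0 <= n x) -> continuous n -> continuous e -> off_box N e ->
  (forall eta, 0 < eta <= 1 -> exists2 G, zero_mean N G & forall x,
    (a ^+ 2 * s x / (s x + eta) ^+ 2 + c * rho (s x)) * n x <= e x + G x) ->
  (c%:E * integral_Rd (fun x => (n x * rho (s x))%:E) <=
   integral_Rd (fun x => (e x)%:E) -
     (a ^+ 2)%:E * integral_Rd (fun x => (n x / s x)%:E))%E.
Proof.
move=> c0 n0 cn ce e0 H.
have cs : continuous s by have [] := has_grad_dist2 (0 : E).
have ms : measurable_fun [set: d.-tuple T] (s \o row_of).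
  exact: continuous_measurable_row.
have mn : measurable_fun [set: d.-tuple T] (n \o row_of).
  exact: continuous_measurable_row.
have mr : measurable_fun [set: d.-tuple T] (fun t => rho (s (row_of t))).
  by apply: measurable_rho => // t; exact: dist2_ge0.
have ie := off_box_integrable ce e0.
pose mu := @lebesgue_tuple R d.
have eX : integral_Rd (fun x => (e x)%:E) = (\int[mu]_t (e (row_of t))%:E)%E by [].
have fX : (\int[mu]_t (e (row_of t))%:E \is a fin_num)%E by exact: integrable_fin_num.
pose h k (t : d.-tuple T) := a ^+ 2 * (n (row_of t) * (s (row_of t) / (s (row_of t) + k.+1%:R^-1) ^+ 2))
   + c * (n (row_of t) * rho (s (row_of t))).
have mq k : measurable_fun [set: d.-tuple T]
    (fun t => n (row_of t) * (s (row_of t) / (s (row_of t) + k.+1%:R^-1) ^+ 2)).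
  apply: measurable_funM => //; apply: measurable_funM => //.
  apply: measurable_fun_posV => [|t]; last first.
    by rewrite exprn_gt0// ltr_wpDl ?dist2_ge0.
  by apply: measurable_funX; apply: measurable_funD.
have mh k : measurable_fun [set: d.-tuple T] (h k).
  by apply: measurable_funD; apply: measurable_funM => //; exact: measurable_funM.
have r0 x : 0 <= rho (s x) by rewrite rho_ge0// dist2_ge0.
have h0 k t : 0 <= h k t.
  by rewrite addr_ge0// mulr_ge0 ?sqr_ge0// mulr_ge0// divr_ge0 ?sqr_ge0 ?dist2_ge0.
have nd t : {homo h ^~ t : i j / (i <= j)%N >-> i <= j}.
  move=> i j ij; rewrite lerD2r ler_wpM2l ?sqr_ge0// ler_wpM2l//.
  exact: (hardy_quotient_homo (dist2_ge0 _ _)).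
pose g t := a ^+ 2 * (n (row_of t) / s (row_of t)) + c * (n (row_of t) * rho (s (row_of t))).
have cv t : h ^~ t @ \oo --> g t.
  apply: cvgD; last exact: cvg_cst.
  apply: cvgM; first exact: cvg_cst.
  apply: cvgM; first exact: cvg_cst.
  exact: (hardy_quotient_cvg (dist2_ge0 _ _)).
have hX k : (\int[mu]_t (h k t)%:E <= \int[mu]_t (e (row_of t))%:E)%E.
  have eta01 : 0 < (k.+1%:R^-1 : R) <= 1.
    by rewrite invr_gt0 ltr0Sn/= invf_le1 ?ler1n ?ltr0Sn.
  have [G [cG G0 iG] HG] := H _ eta01.
  have iGG := off_box_integrable cG G0.
  rewrite -[leRHS]adde0 -iG -integralD//.
  apply: ge0_le_integral => //.
  - by move=> t _; rewrite lee_fin.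
  - exact/measurable_EFinP.
  - by apply: emeasurable_funD; [case/integrableP: ie|case/integrableP: iGG].
  - move=> t _; rewrite -EFinD lee_fin; apply: le_trans (HG (row_of t)).
    by rewrite /h le_eqVlt; apply/orP; left; apply/eqP; ring.
have := integral_le_sup_cvg mh h0 nd cv hX.
have mQ : measurable_fun [set: d.-tuple T] (fun t => n (row_of t) / s (row_of t)).
  apply: (measurable_fun_cvg mq) => t _; apply: cvgM; first exact: cvg_cst.
  exact: (hardy_quotient_cvg (dist2_ge0 _ _)).
have Q0 t : 0 <= n (row_of t) / s (row_of t) by rewrite divr_ge0 ?dist2_ge0.
have -> : (\int[mu]_t (g t)%:E = (a ^+ 2)%:E * integral_Rd (fun x => (n x / s x)%:E)
   + c%:E * integral_Rd (fun x => (n x * rho (s x))%:E))%E.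
  rewrite /integral_Rd -ge0_integralZl_EFin//; last 3 first.
  - by move=> t _; rewrite lee_fin; exact: Q0.
  - exact/measurable_EFinP.
  - exact: sqr_ge0.
  rewrite -ge0_integralZl_EFin//; last 2 first.
  - by move=> t _; rewrite lee_fin mulr_ge0.
  - by apply/measurable_EFinP; exact: measurable_funM.
  rewrite -ge0_integralD//.
  - by move=> t _; rewrite mule_ge0// lee_fin ?sqr_ge0//; exact: Q0.
  - by apply: measurable_funeM; exact/measurable_EFinP.
  - by move=> t _; rewrite mule_ge0// lee_fin// mulr_ge0.
  - by apply: measurable_funeM; apply/measurable_EFinP; exact: measurable_funM.
rewrite -eX in fX *.
have Q'0 : (0 <= (a ^+ 2)%:E * integral_Rd (fun x : E => (n x / s x)%:E))%E.
  by rewrite mule_ge0 ?lee_fin ?sqr_ge0// integral_ge0// => t _; rewrite lee_fin; exact: Q0.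
have Z'0 : (0 <= c%:E * integral_Rd (fun x : E => (n x * rho (s x))%:E))%E.
  by rewrite mule_ge0 ?lee_fin// integral_ge0// => t _; rewrite lee_fin mulr_ge0.
(* Subtraction in the extended reals needs a finite Hardy term; it is at most the integral of [e],
   which is finite. *)
move=> le; rewrite leeBrDl// ge0_fin_numE//.
apply: (@le_lt_trans _ _ (integral_Rd (fun x => (e x)%:E))).
  by apply: le_trans le; rewrite leeDl.
by rewrite ltey_eq fX.
Qed.

End integration.

(** * The theorem *)

Section frame.
Context {R : realType} {d : nat}.
Local Notation E := 'rV[R]_d.
Local Notation s := (dist2 (0 : E)).
Local Open Scope classical_set_scope.

Lemma enorm_sqr (x : E) : enorm x ^+ 2 = s x.
Proof.
rewrite /enorm sqr_sqrtr; last by apply: sumr_ge0 => i _; exact: sqr_ge0.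
by apply: eq_bigr => i _; rewrite mxE subr0.
Qed.

Lemma enormE (x : E) : enorm x = Num.sqrt (s x).
Proof. by congr Num.sqrt; apply: eq_bigr => i _; rewrite mxE subr0. Qed.

Lemma normc_sqr (w : R[i]) : normc w ^+ 2 = complex.Re w ^+ 2 + complex.Im w ^+ 2.
Proof. by case: w => u v /=; rewrite sqr_sqrtr// addr_ge0 ?sqr_ge0. Qed.

Lemma magnetic_grad_sqnormE (A : E -> E) (psi : E -> R[i]) x :
  let f y := complex.Re (psi y) in let g y := complex.Im (psi y) in
  let A' j y := A y 0 j in
  magnetic_grad_sqnorm A psi x =
  \sum_(j < d) (cov_re g (partial^~ f) A' j x ^+ 2 + cov_im f (partial^~ g) A' j x ^+ 2).
Proof.
move=> f g A'; apply: eq_bigr => j _; rewrite normc_sqr /magnetic_grad mxE /partialC.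
rewrite /cov_re /cov_im -/f -/g /A' /f /g; case: (psi x) => u v /=.
by congr (_ ^+ 2 + _ ^+ 2); ring.
Qed.

Lemma test_function_off_box (psi : E -> R[i]) : test_function psi ->
  exists N, off_box N (fun x => complex.Re (psi x)) /\ off_box N (fun x => complex.Im (psi x)).
Proof.
move=> [_ /compact_bounded[M [_ hM]]].
have psi0 (x : E) : (exists i, `|M| + 1 < `|x 0 i|) -> psi x = 0.
  move=> [i xi]; apply/eqP; apply/negPn/negP => px.
  have : `|x| <= `|M| + 1.
    apply: hM; first by rewrite (le_lt_trans (ler_norm _))// ltrDl.
    exact: subset_closure.
  apply/negP; rewrite -ltNge; apply: lt_le_trans xi _.
  rewrite [leRHS]/Num.norm/= mx_normrE; apply/bigmax_geP; right => /=.
  by exists (0, i).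
by exists (`|M| + 1); split => x /psi0 ->.
Qed.

Lemma dist2_lt_ball (z x : E) (u : R) : 0 < u -> dist2 z x < u ^+ 2 -> ball z u x.
Proof.
move=> u0 h; split => // i j; rewrite /ball/= (ord1 i) distrC.
rewrite -(ltr_pXn2r (n := 2))// ?nnegrE ?(ltW u0)// real_normK ?num_real//.
apply: le_lt_trans h; rewrite /dist2 (bigD1 j)//= lerDl.
by apply: sumr_ge0 => k _; exact: sqr_ge0.
Qed.

Lemma dist2_gt0 (x : E) : x != 0 -> 0 < s x.
Proof.
move=> x0; rewrite lt_neqAle dist2_ge0 andbT eq_sym; apply: contra x0 => s0.
apply/eqP/rowP => j; rewrite mxE; apply/eqP; rewrite -sqrf_eq0 eq_le sqr_ge0 andbT.
rewrite -(eqP s0) /dist2 (bigD1 j)//= !mxE subr0 lerDl.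
by apply: sumr_ge0 => k _; exact: sqr_ge0.
Qed.

(** Antisymmetry allows a nonzero entry to be taken positive by swapping its indices. If it was
    found at the origin, continuity lets the point move slightly; a centre away from [0] is where
    [V] is bounded uniformly in [eta]. *)
Lemma nonzero_2form (B : E -> 'M[R]_d) : smooth_2form B -> ~ (forall x, B x = 0) ->
  exists z j k, z != 0 /\ 0 < B z j k.
Proof.
move=> [antiB smB] /existsNP[x Bx].
have [j [k Bjk]] : exists j k, 0 < B x j k.
  have [j [k]] : exists j k, B x j k != 0.
    apply: contrapT => h'; apply: Bx; apply/matrixP => j k; rewrite mxE.
    by apply: contrapT => /eqP b; apply: h'; exists j, k.
  have := antiB x => /matrixP /(_ j k); rewrite !mxE => e.
  by rewrite neq_lt => /orP[b|b]; [exists k, j; rewrite e oppr_gt0|exists j, k].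
have [x0|x0] := eqVneq x 0; last by exists x, j, k.
have cB : continuous (fun y => B y j k) by have [] := smB j k [::].
have : \forall y \near (x : E), 0 < B (y : E) j k by exact: (cvgr_gt _ (cB x)).
move=> h; have [u /= u0 hu] := (nbhs_ballP x _).1 h.
exists ((u / 2) *: delta_mx 0 j), j, k; split.
  apply/negP => /eqP/rowP/(_ j)/eqP; rewrite !mxE !eqxx/= mulr1 mulf_eq0.
  by rewrite gt_eqF//= invr_eq0 pnatr_eq0.
apply: hu; split => // i l; rewrite x0 !mxE /ball/= sub0r normrN normrM.
rewrite gtr0_norm ?divr_gt0// normr_nat.
have : u / 2 < u by rewrite gtr_pMr// invf_lt1// ltr1n.
by case: (_ && _); rewrite ?mulr1 ?mulr0.
Qed.

End frame.

(* For d = 2 the Hardy term is 0%:E * _ , which is 0 in \bar R even when the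
   integral is +oo. The integrands are real quotients, with 1 / 0 = 0 and
   ln 0 = 0; this only concerns the null set {0}. *)
Theorem theorem1p1 (R : realType) (d : nat) (B : 'rV[R]_d -> 'M[R]_d) :
  (2 <= d)%N ->
  smooth_2form B -> closed_2form B ->
  ~ (forall x, B x = 0) ->
  exists c : R, 0 < c /\
    forall (A : 'rV[R]_d -> 'rV[R]_d) (psi : 'rV[R]_d -> R[i]),
      smooth_1form A -> (forall x, ext_d1 A x = B x) -> test_function psi ->
      (integral_Rd (fun x => (magnetic_grad_sqnorm A psi x)%:E)
       - (hardy_const R d)%:E *
         integral_Rd (fun x => (normc (psi x) ^+ 2 / enorm x ^+ 2)%:E)
       >= c%:E *
         integral_Rd (fun x => (normc (psi x) ^+ 2 /
           (1 + enorm x ^+ 2 * ln (enorm x) ^+ 2))%:E))%E.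
Proof.
move=> d2 smB _ Bn0.
have [z [j [k [z0 Bz]]]] := nonzero_2form smB Bn0.
have cB : continuous (fun y => B y j k) by have [] := (smB.2 j k) [::].
have cs : continuous (dist2 (0 : 'rV[R]_d)) by have [] := has_grad_dist2 (0 : 'rV[R]_d).
have sz0 := dist2_gt0 z0.
have hb : B z j k / 2 < B z j k by rewrite gtr_pMr// invf_lt1// ltr1n.
have hs : dist2 0 z / 2 < dist2 0 z by rewrite gtr_pMr// invf_lt1// ltr1n.
have nB : \forall y \near z, B z j k / 2 < B (y : 'rV[R]_d) j k by exact: (cvgr_gt _ (cB z)).
have ns : \forall y \near z, dist2 0 z / 2 < dist2 0 (y : 'rV[R]_d) by exact: (cvgr_gt _ (cs z)).
(* On this ball [B_jk] and [|x|^2] keep at least half of their values at [z]. The constant obtained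
   from these data is fixed before [A] and [psi] are introduced. *)
have [u /= u0 hu] := (nbhs_ballP z _).1 (filterI nB ns).
pose a : R := (d%:R - 2) / 2.
have a0 : 0 <= a by rewrite divr_ge0// subr_ge0 ler_nat.
have da : d%:R = 2 * (a + 1) by rewrite /a; field.
have u20 : 0 < u ^+ 2 by rewrite exprn_gt0.
have bz20 : 0 < B z j k / 2 by rewrite divr_gt0.
have sz20 : 0 < dist2 0 z / 2 by rewrite divr_gt0.
have [c c0 H] := magnetic_hardy_pointwise z j k a0 da bz20 sz20 u20.
exists c; split => // A psi smA dAB tpsi.
have [[smf smg] _] := tpsi.
have [N [f0 g0]] := test_function_off_box tpsi.
pose f (x : 'rV[R]_d) := complex.Re (psi x); pose g (x : 'rV[R]_d) := complex.Im (psi x).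
pose A' (i : 'I_d) (x : 'rV[R]_d) := A x 0 i.
have hf := smooth_has_grad smf; have hg := smooth_has_grad smg.
have hdf i := smooth_has_grad (smooth_partial i smf).
have hdg i := smooth_has_grad (smooth_partial i smg).
have hA i := smooth_has_grad (smA i).
have HD x : dist2 z x < u ^+ 2 -> B z j k / 2 <= partial j (A' k) x - partial k (A' j) x
    /\ dist2 0 z / 2 <= dist2 0 x.
  move=> /(dist2_lt_ball u0) /hu[/ltW hB /ltW hsx]; split => //.
  by apply: le_trans hB _; rewrite -dAB mxE.
have := @integral_hardy_weight R d a c N (density f g)
  (fun x => \sum_(i < d) (cov_re g (partial^~ f) A' i x ^+ 2 + cov_im f (partial^~ g) A' i x ^+ 2)).
have -> : (fun x => (magnetic_grad_sqnorm A psi x)%:E) =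
  (fun x => (\sum_(i < d) (cov_re g (partial^~ f) A' i x ^+ 2 +
     cov_im f (partial^~ g) A' i x ^+ 2))%:E).
  by apply/funext => x; rewrite magnetic_grad_sqnormE.
have -> : (fun x => (normc (psi x) ^+ 2 / enorm x ^+ 2)%:E) =
  (fun x => (density f g x / dist2 0 x)%:E).
  by apply/funext => x; rewrite normc_sqr enorm_sqr.
have -> : (fun x => (normc (psi x) ^+ 2 / (1 + enorm x ^+ 2 * ln (enorm x) ^+ 2))%:E) =
  (fun x => (density f g x * rho (dist2 0 x))%:E).
  by apply/funext => x; rewrite normc_sqr enorm_sqr enormE /rho div1r.
apply.
- exact: ltW.
- by move=> x; rewrite addr_ge0 ?sqr_ge0.
- by have [] := has_grad_density hf hg.
- exact: (continuous_energy hf hg hdf hdg hA).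
- move=> x xN; rewrite big1// => i _.
  rewrite /cov_re /cov_im (off_box_grad i hf f0 xN) (off_box_grad i hg g0 xN).
  by rewrite /f /g (f0 x xN) (g0 x xN) !mulr0 addr0 subr0 expr0n addr0.
- move=> eta eta01.
  have [G zG HG] := H f g _ _ _ _ A' _ N eta hf hg hdf hdg hA f0 g0 HD eta01.
  by exists G.
Qed.
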